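(* Let $(\Omega,\mathcal F,\mathbf P)$ be a probability space, let $T_1,\dots,T_M$ be measure-preserving Markov operators on it, let $\kappa\in(0,1)$, let $(\theta_1,\dots,\theta_M)$ be a probability vector, and set $c_i=\frac{\theta_i}{1-\kappa}$ for $i=1,\dots,M$. The following statements are equivalent. (a) (Entropy subadditivity) For all $f\in L\log L$, $$\sum_{i=1}^M\theta_i\,\mathrm{Ent}(T_i^\star f)\le(1-\kappa)\,\mathrm{Ent}(f).$$ (b) (Generalized Brascamp-Lieb inequality) For all $\varphi_1,\dots,\varphi_M\in L^\infty$, $$\mathbf E\Big[\prod_{i=1}^M e^{c_iT_i\varphi_i}\Big]\le\prod_{i=1}^M\mathbf E\big[e^{\varphi_i}\big]^{c_i}.$$
   Context: $L^p=L^p(\Omega,\mathcal F,\mathbf P)$, and $\mathbf E$ is expectation with respect to $\mathbf P$. $L\log L$ is the set of measurable $f:\Omega\to\mathbb R_+$ with $\mathbf E[|f\log f|]<\infty$, and $\mathrm{Ent}(f)=\mathbf E[f\log f]-\mathbf E[f]\log\mathbf E[f]$. A transition kernel on $\Omega$ is a function $T:\Omega\times\mathcal F\to[0,1]$ such that $T(x,\cdot)$ is a probability measure for each $x$ and $T(\cdot,E)$ is measurable for each $E\in\mathcal F$. It is identified with the Markov operator $(Tf)(x)=\int_\Omega f(y)\,T(x,dy)$. It is measure-preserving if $\mathbf E[Tf]=\mathbf E[f]$ for all $f\in L^\infty$ (a standing assumption for all Markov operators); $T$ then extends to a bounded operator on every $L^p$, $p\in[1,\infty]$. Its adjoint $T^\star$,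 characterized by $\mathbf E[(T^\star f)g]=\mathbf E[(Tg)f]$ for $f,g\in L^2$, is again a measure-preserving Markov operator, and $T^\star f$ is well defined and in $L\log L$ for $f\in L\log L$. *)

(* Defs.v *)
From HB Require Import structures.
From mathcomp Require Export all_boot all_order all_algebra.
From mathcomp Require Export all_classical all_reals all_analysis.

Set Implicit Arguments.
Unset Strict Implicit.
Unset Printing Implicit Defensive.

Export Order.TTheory GRing.Theory Num.Theory.
Export numFieldNormedType.Exports.

Local Open Scope classical_set_scope.
Local Open Scope ring_scope.

(* Real-valued functions stand for their classes modulo a.e. equality.  If [T]
   preserves [P] and f is in L^1, then f is (T x)-integrable for P-almost every
   x; on the exceptional null set the value is a default one. *)
Definition markov_op (d : measure_display) (Omega : measurableType d)
    (R : realType) (T : R.-pker Omega ~> Omega) (f : Omega -> R) : Omega -> R :=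
  fun x => \int[T x]_y f y.

Definition measure_preserving (d : measure_display) (Omega : measurableType d)
    (R : realType) (P : probability Omega R) (T : R.-pker Omega ~> Omega) : Prop :=
  forall f : Omega -> R, f \in Lfun P +oo%E ->
    ('E_P[markov_op T f] = 'E_P[f])%E.

(* [S] is the L^2-adjoint of [T], extended to a bounded linear operator on L^1;
   L^2 being dense in L^1, this determines S f up to a.e. equality for every f
   in L^1. *)
Definition is_adjoint (d : measure_display) (Omega : measurableType d)
    (R : realType) (P : probability Omega R) (T : R.-pker Omega ~> Omega)
    (S : (Omega -> R) -> (Omega -> R)) : Prop :=
  [/\ forall f g : Omega -> R, f \in Lfun P 2%:E -> g \in Lfun P 2%:E ->
        S f \in Lfun P 2%:E /\
        ('E_P[(S f \* g)%R] = 'E_P[(markov_op T g \* f)%R])%E,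
      forall f : Omega -> R, f \in Lfun P 1%E -> S f \in Lfun P 1%E,
      forall (a : R) (f g : Omega -> R), f \in Lfun P 1%E -> g \in Lfun P 1%E ->
        {ae P, forall x, S (fun y => a * f y + g y) x = a * S f x + S g x}
    & exists C : R, forall f : Omega -> R, f \in Lfun P 1%E ->
        ('N[P]_1[EFin \o S f] <= C%:E * 'N[P]_1[EFin \o f])%E].

(* The adjoint exists, and is unique up to a.e. equality, as soon as [T]
   preserves [P]: for f in L^1 it is the Radon-Nikodym derivative with respect
   to [P] of the signed measure sending E to the expectation of f (T 1_E).  The
   default value [cst 0] is thus never used for measure-preserving [T].  On a
   general probability space the adjoint need not be given by a kernel, hence
   its definition as an operator on functions. *)
Definition adjoint (d : measure_display) (Omega : measurableType d)
    (R : realType) (P : probability Omega R) (T : R.-pker Omega ~> Omega) :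
    (Omega -> R) -> (Omega -> R) :=
  xget (fun _ => cst 0) [set S | is_adjoint P T S].

(* [ln 0 = 0], which gives the usual convention 0 log 0 = 0. *)
Definition LlogL (d : measure_display) (Omega : measurableType d)
    (R : realType) (P : probability Omega R) : set (Omega -> R) :=
  [set f : Omega -> R | [/\ measurable_fun setT f, forall x, 0 <= f x
             & ('E_P[fun x => `|f x * ln (f x)|%R] < +oo)%E]].

(* If E[f] = 0, the second term is 0 * -oo = 0. *)
Definition Ent (d : measure_display) (Omega : measurableType d)
    (R : realType) (P : probability Omega R) (f : Omega -> R) : \bar R :=
  ('E_P[fun x => (f x * ln (f x))%R] - 'E_P[f] * lne 'E_P[f])%E.

(* Main.v *)
Require Import Defs.
From HB Require Import structures.
From mathcomp Require Import measurable_realfun ess_sup_inf ring lra.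

Set Implicit Arguments.
Unset Strict Implicit.
Unset Printing Implicit Defensive.

Local Open Scope classical_set_scope.
Local Open Scope charge_scope.
Local Open Scope ring_scope.

(** Both statements are dual to each other through the Gibbs variational
    principle: for a density [f] and a bounded [phi],
      E[f phi] <= Ent(f) + ln E[exp phi],
    with equality when [f] is proportional to [exp phi].  It follows by
    integrating Young's inequality ([mulr_ln_young], [gibbs],
    [Ent_gibbs_density]).  Let [S i] be the adjoint of [T i] and [F] the sum of
    the [c i * T i (phi i)], so that E[f F] is the sum of the
    [c i * E[S i f * phi i]].

    Subadditivity implies the Brascamp-Lieb inequality: take for [f] the density
    proportional to [exp F], write ln E[exp F] = E[f F] - Ent(f), and bound each
    E[S i f * phi i] by Ent(S i f) + ln E[exp (phi i)]
    ([brascamp_lieb_of_entropy]).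

    Conversely, for a given [f] apply the principle to [f] and [F], then the
    Brascamp-Lieb inequality, and let [phi i] tend to [ln (S i f)], which makes
    the pairing with [phi i] tend to the entropy of [S i f].  As this logarithm
    is unbounded, it is replaced by [ln (min (S i f) n + e)]: the error in [e]
    is controlled explicitly, and the limit in [n] is monotone
    ([entropy_of_brascamp_lieb], [cvg_cut_mul_ln]).

    The adjoint is defined by choice among the operators with the required
    properties, so such an operator has to be constructed.  For an integrable
    [f] it is the density of the image under [T] of the measure [f P], which
    [P] dominates because [T] preserves [P] ([adjoint_pair_ex]).  Boundedness
    in L^1 and in L^2 and linearity follow from well-chosen test functions
    ([adjoint_pair_norm], [adjoint_pair_sqr], [adjoint_pair0]), and dominated
    convergence extends the pairing to L^2 ([is_adjoint_ex]).  Conversely, every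
    operator with these properties satisfies E[S f * g] = E[f * T g] for
    integrable [f] and bounded [g] ([is_adjoint_pair]), and testing this on
    constants and indicators shows that it preserves mass and positivity
    ([adjoint_pair_mass], [adjoint_pair_ge0]). *)

(** * The image of a density under a kernel *)

Section weighted_image.
Context (d : measure_display) (Omega : measurableType d) (R : realType).
Variables (P : probability Omega R) (T : R.-pker Omega ~> Omega).
Variable f : Omega -> R.
Hypothesis f_ge0 : forall x, 0 <= f x.
Hypothesis f_int : P.-integrable setT (EFin \o f).
Local Open Scope ereal_scope.
Import HBNNSimple.

Let mf : measurable_fun setT (fun x => (f x)%:E).
Proof. exact: measurable_int f_int. Qed.

(** The image under [T] of the measure with density [f] with respect to [P].
    Its Radon-Nikodym derivative will be the adjoint of [T] applied to [f]. *)
Definition weighted_image (A : set Omega) : \bar R :=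
  \int[P]_x ((f x)%:E * T x A).

Local Notation nu := weighted_image.

Let weighted_image0 : nu set0 = 0.
Proof. by rewrite /nu integral0_eq// => x _; rewrite measure0 mule0. Qed.

Let weighted_image_ge0 A : 0 <= nu A.
Proof. by apply: integral_ge0 => x _; rewrite mule_ge0 ?lee_fin. Qed.

Let weighted_image_sigma_additive : semi_sigma_additive nu.
Proof.
move=> F mF tF mUF.
have -> : nu (\bigcup_n F n) = \sum_(n <oo) nu (F n).
  rewrite /nu -integral_nneseries//; last 2 first.
    by move=> n; apply: emeasurable_funM => //; exact: measurable_kernel.
    by move=> n x _; rewrite mule_ge0 ?lee_fin.
  apply: eq_integral => x _.
  rewrite measure_semi_bigcup// nneseriesZl// => n _; exact: measure_ge0.
by apply: is_cvg_nneseries => n _ _; exact: weighted_image_ge0.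
Qed.

HB.instance Definition _ := isMeasure.Build d Omega R nu
  weighted_image0 weighted_image_ge0 weighted_image_sigma_additive.

Let weighted_image_finite : fin_num_fun nu.
Proof.
apply: lty_fin_num_fun => /=; rewrite /nu.
under eq_integral do rewrite prob_kernel mule1.
by rewrite ltey_eq integrable_fin_num.
Qed.

HB.instance Definition _ := Measure_isFinite.Build d Omega R nu
  weighted_image_finite.

Definition weighted_image_measure : {finite_measure set Omega -> \bar R} :=
  weighted_image.

(** On a simple function both sides are the finite sum of the values [r] times
    the weighted image of the level set of [r]; monotone convergence on the
    left, and twice on the right, reaches every nonnegative function. *)
Lemma integral_weighted_image (g : Omega -> \bar R) :
  (forall x, 0 <= g x) -> measurable_fun setT g ->
  \int[weighted_image_measure]_y g y = \int[P]_x ((f x)%:E * \int[T x]_y g y).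
Proof.
move=> g0 mg.
rewrite /weighted_image_measure.
have int_nnsfun (h : {nnsfun Omega >-> R}) :
    \int[nu]_y (h y)%:E = \int[P]_x ((f x)%:E * \int[T x]_y (h y)%:E).
  have mT r : measurable_fun setT (fun x => T x (h @^-1` [set r])).
    exact: measurable_kernel.
  transitivity (\int[P]_x (\sum_(r \in range h)
      (f x)%:E * (r%:E * T x (h @^-1` [set r])))).
    rewrite integralT_nnsfun sintegralE ge0_integral_fsum//; last 2 first.
    - by move=> r; apply: emeasurable_funM => //; exact: measurable_funeM.
    - move=> r x _; rewrite mule_ge0 ?lee_fin//.
      have [r0|r0] := leP 0%R r; first by rewrite mule_ge0.
      by rewrite preimage_nnfun0// measure0 mule0.
    apply: eq_fsbigr => r /set_mem [y _ <-].
    rewrite -ge0_integralZl ?lee_fin//; last 2 first.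
    - exact: emeasurable_funM.
    - by move=> x _; rewrite mule_ge0 ?lee_fin.
    by apply: eq_integral => x _; rewrite muleCA.
  apply: eq_integral => x _.
  rewrite integralT_nnsfun sintegralE ge0_mule_fsumr// => r.
  have [r0|r0] := leP 0%R r; first by rewrite mule_ge0.
  by rewrite preimage_nnfun0// measure0 mule0.
pose h := nnsfun_approx measurableT mg.
have mhE n : measurable_fun setT (fun x => (h n x)%:E).
  exact/measurable_EFinP.
have h0E n x : 0 <= (h n x)%:E by rewrite lee_fin.
have ndh x : {homo (fun n => (h n x)%:E) : a b / (a <= b)%N >-> a <= b}.
  by move=> a b ab; rewrite lee_fin; exact/lefP/nd_nnsfun_approx.
have limh x : lim ((h n x)%:E @[n --> \oo]) = g x.
  by apply/cvg_lim => //; exact: cvg_nnsfun_approx.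
have mint n : measurable_fun setT (fun x => \int[T x]_y (h n y)%:E).
  apply: measurable_fun_integral_kernel => //.
  exact: measurable_kernel.
have intE (m : {measure set Omega -> \bar R}) :
    \int[m]_y (h n y)%:E @[n --> \oo] --> \int[m]_y g y.
  rewrite (_ : \int[m]_y g y = \int[m]_y lim ((h n y)%:E @[n --> \oo])).
  2: by apply: eq_integral => y _; rewrite limh.
  by apply: cvg_monotone_convergence => // x _ a b; exact: ndh.
have ndint x : {homo (fun n => \int[T x]_y (h n y)%:E) :
    a b / (a <= b)%N >-> a <= b}.
  move=> a b ab; apply: ge0_le_integral => //.
  by move=> y _; exact: ndh.
have nuE : \int[nu]_y (h n y)%:E @[n --> \oo] -->
    \int[P]_x ((f x)%:E * \int[T x]_y g y).
  under eq_fun do rewrite int_nnsfun.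
  have -> : \int[P]_x ((f x)%:E * \int[T x]_y g y) =
      \int[P]_x lim ((f x)%:E * \int[T x]_y (h n y)%:E @[n --> \oo]).
    apply: eq_integral => x _; apply/esym/cvg_lim => //.
    by apply: cvgeZl => //; exact: intE.
  apply: cvg_monotone_convergence => //.
  - by move=> n; exact: emeasurable_funM.
  - by move=> n x _; rewrite mule_ge0 ?lee_fin// integral_ge0.
  - by move=> x _ a b ab; rewrite lee_pmul ?lee_fin ?integral_ge0 ?ndint.
by move/cvg_lim : nuE => <- //; apply/esym/cvg_lim => //; exact: intE.
Qed.
End weighted_image.

(** * Bounded measurable functions *)

(** The test functions of the duality.  The bound holds everywhere, and not
    only almost everywhere, so that they are integrable for every [T x]. *)
Definition bounded_mfun (d : measure_display) (Omega : measurableType d)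
    (R : realType) (g : Omega -> R) : Prop :=
  measurable_fun setT g /\ exists K, forall x, `|g x| <= K.

Section bounded_mfun.
Context (d : measure_display) (Omega : measurableType d) (R : realType).
Implicit Types (mu : {measure set Omega -> \bar R}) (f g h : Omega -> R).

Lemma integrable_mfun mu f : mu.-integrable setT (EFin \o f) ->
  measurable_fun setT f.
Proof. by move=> /measurable_int /measurable_EFinP. Qed.

Lemma integrable_dominated mu f g : measurable_fun setT f ->
  (forall x, `|f x| <= g x) -> mu.-integrable setT (EFin \o g) ->
  mu.-integrable setT (EFin \o f).
Proof.
move=> mf fg; apply: le_integrable => //; first exact/measurable_EFinP.
by move=> x _; rewrite /= lee_fin (le_trans (fg x))// ler_norm.
Qed.

Lemma integrable_bounded mu g : (mu setT < +oo)%E -> bounded_mfun g ->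
  mu.-integrable setT (EFin \o g).
Proof.
move=> mufin [mg [K gK]].
apply: measurable_bounded_integrable => //.
exists K; split; first exact: num_real.
by move=> M KM x _; rewrite /= (le_trans (gK x))// ltW.
Qed.

Lemma integrable_norm mu f : mu.-integrable setT (EFin \o f) ->
  mu.-integrable setT (EFin \o (fun x => `|f x|)).
Proof. exact: integrable_abse. Qed.

Lemma integrable_bounded_probability (P : probability Omega R) g :
  bounded_mfun g -> P.-integrable setT (EFin \o g).
Proof.
by apply: integrable_bounded; rewrite ltey_eq; apply/orP; left;
  exact: fin_num_measure.
Qed.

Lemma integrable_mul_bounded mu f g : mu.-integrable setT (EFin \o f) ->
  bounded_mfun g -> mu.-integrable setT (EFin \o (f \* g)).
Proof.
move=> intf [mg [K gK]]; have mf := integrable_mfun intf.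
apply: (@integrable_dominated _ _ (fun x => K * `|f x|)).
- exact: measurable_funM.
- by move=> x; rewrite /= normrM mulrC ler_wpM2r.
- exact: integrableZl (integrable_norm intf).
Qed.

Lemma EFin_Rintegral mu f : mu.-integrable setT (EFin \o f) ->
  (\int[mu]_x f x)%:E = (\int[mu]_x (f x)%:E)%E.
Proof.
by move=> intf; rewrite /Rintegral fineK//; exact: integrable_fin_num.
Qed.

(** Integrals are computed on expressions of the form [a * f x + g x]; this is
    where coefficients [1] and summands [0] come from below. *)
Lemma integrable_combination mu a f g : mu.-integrable setT (EFin \o f) ->
  mu.-integrable setT (EFin \o g) ->
  mu.-integrable setT (EFin \o (fun x => a * f x + g x)).
Proof.
move=> intf intg.
by have /(integrableD measurableT)/(_ intg) := integrableZl measurableT a intf.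
Qed.

Lemma Rintegral_combination mu a f g : mu.-integrable setT (EFin \o f) ->
  mu.-integrable setT (EFin \o g) ->
  \int[mu]_x (a * f x + g x) = a * \int[mu]_x f x + \int[mu]_x g x.
Proof.
move=> intf intg; rewrite RintegralD ?RintegralZl//.
by have := integrableZl measurableT a intf.
Qed.

Lemma bounded_cst (c : R) : bounded_mfun (fun _ : Omega => c).
Proof. by split => //; exists `|c|. Qed.

Lemma bounded_combination a f g : bounded_mfun f -> bounded_mfun g ->
  bounded_mfun (fun x => a * f x + g x).
Proof.
move=> [mf [K fK]] [mg [L gL]]; split.
  by apply: measurable_funD => //; exact: measurable_funM.
exists (`|a| * K + L) => x; rewrite (le_trans (ler_normD _ _))// lerD//.
by rewrite normrM ler_wpM2l.
Qed.

Lemma bounded_indic (A : set Omega) : measurable A ->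
  bounded_mfun (\1_A : Omega -> R).
Proof.
move=> mA; split; first exact: measurable_indic.
by exists 1 => x; rewrite indicE; case: (_ \in _); rewrite ?normr1 ?normr0.
Qed.

Lemma bounded_Lfun (P : probability Omega R) p g : (1 <= p)%E ->
  bounded_mfun g -> g \in Lfun P p.
Proof.
move=> p1 [mg [K gK]].
suff : g \in Lfun P +oo%E.
  move=> gy; apply: (Lfun_subset p1 (leey 1%E) _ (leey p) gy).
  exact: fin_num_measure.
apply/andP; split; rewrite inE//= /finite_norm unlock /Lnorm.
case: ifPn => // _; apply: le_lt_trans (ltry K).
by apply/ess_supP/nearW => x /=; rewrite lee_fin.
Qed.

End bounded_mfun.

(** * Invariance and the Radon-Nikodym construction of the adjoint *)

Section markov_operator.
Context (d : measure_display) (Omega : measurableType d) (R : realType).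
Variables (P : probability Omega R) (T : R.-pker Omega ~> Omega).
Implicit Types f g h : Omega -> R.

Lemma kernel_integrable_bounded g x : bounded_mfun g ->
  (T x).-integrable setT (EFin \o g).
Proof. by apply: integrable_bounded; rewrite prob_kernel ltry. Qed.

Lemma measurable_kernel_integral (g : Omega -> \bar R) :
  (forall x, (0 <= g x)%E) -> measurable_fun setT g ->
  measurable_fun setT (fun x => \int[T x]_y g y)%E.
Proof.
move=> g0 mg; apply: measurable_fun_integral_kernel => //.
exact: measurable_kernel.
Qed.

Lemma measurable_markov_op g : measurable_fun setT g ->
  measurable_fun setT (markov_op T g).
Proof.
move=> mg; rewrite /markov_op /Rintegral.
apply: (measurableT_comp (@fine_measurable R setT measurableT)).
under eq_fun do rewrite integralE.
apply: emeasurable_funB; apply: measurable_kernel_integral => //.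
- by apply: measurable_funepos; exact/measurable_EFinP.
- by apply: measurable_funeneg; exact/measurable_EFinP.
Qed.

Lemma markov_op_le g K x : measurable_fun setT g ->
  (forall y, `|g y| <= K) -> `|markov_op T g x| <= K.
Proof.
move=> mg gK; have bg : bounded_mfun g by split => //; exists K.
rewrite (le_trans (le_normr_Rintegral _ (kernel_integrable_bounded x bg)))//.
have -> : K = \int[T x]_y K by rewrite Rintegral_cst// prob_kernel mulr1.
apply: le_Rintegral => //.
- exact: integrable_norm (kernel_integrable_bounded x bg).
- by apply: kernel_integrable_bounded; split => //; exists `|K|.
Qed.

Lemma bounded_markov_op g : bounded_mfun g -> bounded_mfun (markov_op T g).
Proof.
move=> [mg [K gK]]; split; first exact: measurable_markov_op.
by exists K => x; exact: markov_op_le.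
Qed.

Hypothesis T_preserving : measure_preserving P T.

(** Invariance, tested on the indicator of [A]. *)
Lemma integral_kernel_set (A : set Omega) : measurable A ->
  (\int[P]_x T x A = P A)%E.
Proof.
move=> mA; have := T_preserving (bounded_Lfun P (leey _) (bounded_indic R mA)).
rewrite expectation_indic// => <-; rewrite unlock; apply: eq_integral => x _.
rewrite EFin_Rintegral ?integral_indic ?setIT//.
by apply: kernel_integrable_bounded; exact: bounded_indic.
Qed.

(** The image under [T] of the constant density [1] is [P] itself. *)
Lemma integral_invariant (g : Omega -> \bar R) : (forall x, (0 <= g x)%E) ->
  measurable_fun setT g -> (\int[P]_x (\int[T x]_y g y) = \int[P]_x g x)%E.
Proof.
move=> g0 mg.
have int1 : P.-integrable setT (EFin \o cst 1).
  apply: integrable_bounded_probability; split => //.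
  by exists 1 => x; rewrite normr1.
have := integral_weighted_image T (fun=> ler01) int1 g0 mg.
under [X in _ = X]eq_integral do rewrite mul1e.
move=> <-; apply: eq_measure_integral => A mA _.
transitivity (\int[P]_x T x A)%E; last exact: integral_kernel_set.
by apply: eq_integral => x _; rewrite mul1e.
Qed.

(** [T x A] is nonnegative and averages to [P A].  A single [T x] may well be
    singular with respect to [P], so that only almost every [x] is covered. *)
Lemma kernel_ae0 (A : set Omega) : measurable A -> P A = 0%E ->
  {ae P, forall x, T x A = 0%E}.
Proof.
move=> mA PA0; have := integral_kernel_set mA; rewrite PA0.
under eq_integral do rewrite -[T _ _]gee0_abs//.
move/(ae_eq_integral_abs _ measurableT (measurable_kernel T _ mA)).
by apply: filterS => x /(_ I).
Qed.

Lemma kernel_ae (Q : Omega -> Prop) :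
  {ae P, forall y, Q y} -> {ae P, forall x, {ae T x, forall y, Q y}}.
Proof.
move=> [A [mA PA0 QA]]; apply: filterS (kernel_ae0 mA PA0) => x TA0.
by exists A.
Qed.

Lemma markov_op_ae_eq f g : measurable_fun setT f -> measurable_fun setT g ->
  {ae P, forall x, f x = g x} ->
  {ae P, forall x, markov_op T f x = markov_op T g x}.
Proof.
move=> mf mg /kernel_ae; apply: filterS => x fg.
congr fine; apply: ae_eq_integral => //; try exact/measurable_EFinP.
by apply: filterS fg => y ->.
Qed.

Lemma markov_op_combination a f g : bounded_mfun f -> bounded_mfun g ->
  markov_op T (fun x => a * f x + g x) =
  (fun x => a * markov_op T f x + markov_op T g x).
Proof.
move=> bf bg; apply/funext => x.
by rewrite /markov_op Rintegral_combination//; exact: kernel_integrable_bounded.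
Qed.

Let mul_markov_op f g : P.-integrable setT (EFin \o f) -> bounded_mfun g ->
  P.-integrable setT (EFin \o (f \* markov_op T g)).
Proof. by move=> intf bg; apply/integrable_mul_bounded/bounded_markov_op. Qed.

(** [h] is the adjoint of [T] applied to [f], characterised by bounded test
    functions, which can be paired with every integrable [f] and [h]. *)
Definition adjoint_pair f h := forall g, bounded_mfun g ->
  \int[P]_x (h x * g x) = \int[P]_x (f x * markov_op T g x).

(** Almost every [T x] vanishes on a given [P]-null set, so [P] dominates the
    weighted image, and the Radon-Nikodym derivative is the function sought. *)
Lemma nneg_adjoint_pair_ex f : (forall x, 0 <= f x) ->
  P.-integrable setT (EFin \o f) ->
  exists2 h, P.-integrable setT (EFin \o h) & adjoint_pair f h.
Proof.
move=> f0 intf; have mf := integrable_mfun intf.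
pose nu := weighted_image_measure T f0 intf.
have nuP : nu `<< P.
  apply/null_content_dominatesP => A mA /(kernel_ae0 mA) TA0.
  rewrite /nu /= /weighted_image.
  rewrite (ae_eq_integral (cst 0%E)) ?integral0//.
  - apply: emeasurable_funM; first exact/measurable_EFinP.
    exact: measurable_kernel.
  - by apply: filterS TA0 => x /= -> _; rewrite mule0.
have nu_bounded g : bounded_mfun g -> nu.-integrable setT (EFin \o g).
  by apply: integrable_bounded; rewrite ltey_eq; apply/orP; left;
    exact: fin_num_measure.
have nuE g : bounded_mfun g ->
    \int[nu]_y g y = \int[P]_x (f x * markov_op T g x).
  move=> bg; have [mg [K gK]] := bg.
  have nng g' : (forall x, 0 <= g' x) -> bounded_mfun g' ->
      \int[nu]_y g' y = \int[P]_x (f x * markov_op T g' x).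
    move=> g'0 bg'; have [mg' _] := bg'.
    have /(_ (EFin \o g')) := integral_weighted_image T f0 intf.
    rewrite /Rintegral => ->; last 2 first.
    - by move=> x; rewrite lee_fin.
    - exact/measurable_EFinP.
    congr fine; apply: eq_integral => x _; rewrite EFinM; congr (_ * _)%E.
    by rewrite EFin_Rintegral//; exact: kernel_integrable_bounded.
  have comb a g1 g2 : bounded_mfun g1 -> bounded_mfun g2 ->
      \int[nu]_y g1 y = \int[P]_x (f x * markov_op T g1 x) ->
      \int[nu]_y g2 y = \int[P]_x (f x * markov_op T g2 x) ->
      \int[nu]_y (a * g1 y + g2 y) =
      \int[P]_x (f x * markov_op T (fun y => a * g1 y + g2 y) x).
    move=> bg1 bg2 g1E g2E; rewrite Rintegral_combination ?nu_bounded//.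
    rewrite g1E g2E -Rintegral_combination ?mul_markov_op//.
    rewrite markov_op_combination//; apply: eq_Rintegral => x _.
    by rewrite mulrDr mulrCA.
  have bK := bounded_cst Omega `|K|; have bgK := bounded_combination 1 bg bK.
  (* Adding the bound of g reduces to nonnegative test functions. *)
  have -> : g = (fun x => -1 * `|K| + (1 * g x + `|K|)).
    by apply/funext => x; lra.
  apply: comb => //; apply: nng => // x; rewrite mul1r -lerBlDr sub0r.
  by have := gK x; rewrite ler_norml => /andP[+ _]; apply: le_trans;
    rewrite lerN2 ler_norm.
pose h x := fine (('d (charge_of_finite_measure nu) '/d P) x).
have hE x : (h x)%:E = ('d (charge_of_finite_measure nu) '/d P) x.
  by rewrite fineK// Radon_Nikodym_fin_num.
exists h.
  have -> : EFin \o h = 'd (charge_of_finite_measure nu) '/d P.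
    exact/funext.
  exact: Radon_Nikodym_integrable.
move=> g bg; rewrite -nuE// /Rintegral; congr fine.
rewrite -(Radon_Nikodym_change_of_variables nuP)//; last exact: nu_bounded.
by apply: eq_integral => x _; rewrite EFinM muleC hE.
Qed.

Lemma adjoint_pair_ex f : P.-integrable setT (EFin \o f) ->
  exists2 h, P.-integrable setT (EFin \o h) & adjoint_pair f h.
Proof.
move=> intf; have mf := integrable_mfun intf; have intn := integrable_norm intf.
(* The positive and negative parts of f, written with its absolute value. *)
pose fp x := 2^-1 * (1 * f x + `|f x|) + 0; pose fn x := -1 * f x + fp x.
have ip : P.-integrable setT (EFin \o fp).
  apply: integrable_combination; first exact: integrable_combination.
  exact/integrable_bounded_probability/bounded_cst.
have in_ : P.-integrable setT (EFin \o fn) by exact: integrable_combination.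
have [|h1 ih1 fh1] := nneg_adjoint_pair_ex _ ip.
  move=> x; rewrite /fp addr0 mulr_ge0// mul1r.
  by have := ler_norm (- f x); rewrite normrN; lra.
have [|h2 ih2 fh2] := nneg_adjoint_pair_ex _ in_.
  by move=> x; rewrite /fn /fp; have := ler_norm (f x); lra.
exists (fun x => -1 * h2 x + h1 x); first exact: integrable_combination.
move=> g bg; transitivity (\int[P]_x (-1 * (h2 x * g x) + h1 x * g x)).
  by apply: eq_Rintegral => x _; rewrite mulrDl mulrA.
rewrite Rintegral_combination ?(integrable_mul_bounded ih1)//; last first.
  exact: integrable_mul_bounded.
rewrite fh1// fh2// -Rintegral_combination ?mul_markov_op//.
by apply: eq_Rintegral => x _; rewrite mulrA -mulrDl /fn; congr (_ * _); lra.
Qed.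
End markov_operator.

(** * Clipping *)

Section clipping.
Context (R : realType).
Implicit Types (n : nat) (u : R).

Definition clip n u : R := Num.max (- n%:R) (Num.min u n%:R).

Lemma clip_le n u : `|clip n u| <= n%:R.
Proof.
have n0 : 0 <= n%:R :> R by [].
rewrite ler_norml /clip /Order.max /Order.min.
by case: (ltP u n%:R) => ? /=; case: ifP => /= ?; apply/andP; split; lra.
Qed.

Lemma clip_le_norm n u : `|clip n u| <= `|u|.
Proof.
have n0 : 0 <= n%:R :> R by [].
rewrite ler_norml /clip /Order.max /Order.min.
have := ler_norm u; have := ler_norm (- u); rewrite normrN => ? ?.
by case: (ltP u n%:R) => ?; case: ltP => ?; apply/andP; split; lra.
Qed.

Lemma clip_id n u : `|u| <= n%:R -> clip n u = u.
Proof.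
rewrite ler_norml => /andP[un nu]; rewrite /clip.
by rewrite min_l// max_r.
Qed.

Lemma sub_clip_le n u : `|u - clip n u| <= `|u|.
Proof.
have n0 : 0 <= n%:R :> R by [].
rewrite ler_norml /clip /Order.max /Order.min.
have := ler_norm u; have := ler_norm (- u); rewrite normrN => ? ?.
by case: (ltP u n%:R) => ?; case: ltP => ?; apply/andP; split; lra.
Qed.

Lemma sqr_clip_le n u : clip n u ^+ 2 <= u * clip n u.
Proof.
have n0 : 0 <= n%:R :> R by [].
rewrite /clip /Order.max /Order.min expr2.
by case: (ltP u n%:R) => un; case: ltP => // nu; nra.
Qed.

Lemma clip_near u : \forall n \near \oo, clip n u = u.
Proof.
exists (Num.truncn `|u|).+1 => // n /= un; apply: clip_id.
by rewrite (le_trans (ltW (truncnS_gt _)))// ler_nat.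
Qed.

End clipping.

Section bounded_clip.
Context (d : measure_display) (Omega : measurableType d) (R : realType).

Lemma bounded_clip n (g : Omega -> R) : measurable_fun setT g ->
  bounded_mfun (fun x => clip n (g x)).
Proof.
move=> mg; split; last by exists n%:R => x; exact: clip_le.
by apply: measurable_maxr => //; exact: measurable_minr.
Qed.

Lemma bounded_mul (f g : Omega -> R) : bounded_mfun f -> bounded_mfun g ->
  bounded_mfun (fun x => f x * g x).
Proof.
move=> [mf [K fK]] [mg [L gL]]; split; first exact: measurable_funM.
by exists (K * L) => x; rewrite normrM ler_pM.
Qed.

End bounded_clip.

(** * Norm bounds for the adjoint *)

Section adjoint_pairs.
Context (d : measure_display) (Omega : measurableType d) (R : realType).
Variables (P : probability Omega R) (T : R.-pker Omega ~> Omega).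
Implicit Types f g h : Omega -> R.
Hypothesis T_preserving : measure_preserving P T.

Let L1 f := P.-integrable setT (EFin \o f).

Lemma Rintegral_invariant g : bounded_mfun g ->
  \int[P]_x markov_op T g x = \int[P]_x g x.
Proof.
move=> bg; have := T_preserving (bounded_Lfun P (leey _) bg).
by rewrite unlock => /(congr1 fine).
Qed.

Lemma adjoint_pair_combination a f g h k : L1 f -> L1 g -> L1 h -> L1 k ->
  adjoint_pair P T f h -> adjoint_pair P T g k ->
  adjoint_pair P T (fun x => a * f x + g x) (fun x => a * h x + k x).
Proof.
move=> intf intg inth intk fh gk t bt; have bTt := bounded_markov_op T bt.
transitivity (\int[P]_x (a * (h x * t x) + k x * t x)).
  by apply: eq_Rintegral => x _; rewrite mulrDl mulrA.
rewrite Rintegral_combination ?fh ?gk//; try exact: integrable_mul_bounded.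
rewrite -Rintegral_combination; try exact: integrable_mul_bounded.
by apply: eq_Rintegral => x _; rewrite mulrDl mulrA.
Qed.

(** Test against the sign of [h], whose image under [T] is at most [1]. *)
Lemma adjoint_pair_norm f h : L1 f -> L1 h -> adjoint_pair P T f h ->
  \int[P]_x `|h x| <= \int[P]_x `|f x|.
Proof.
move=> intf inth fh; have mh := integrable_mfun inth.
pose A := [set x | 0 <= h x].
have mA : measurable A.
  rewrite -[A]setTI; have -> : A = h @^-1` `[0, +oo[.
    by apply/seteqP; split => x /=; rewrite in_itv /= andbT.
  exact: mh.
pose s x := 2 * (\1_A x : R) + -1.
have bs : bounded_mfun s.
  exact: bounded_combination (bounded_indic R mA) (bounded_cst _ _).
have s1 x : `|s x| <= 1.
  by rewrite /s indicE ler_norml; case: (_ \in _) => /=; apply/andP; split; lra.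
have hs x : `|h x| = h x * s x.
  rewrite /s indicE; have [h0|h0] := leP 0 (h x).
    by rewrite mem_set// ger0_norm//=; lra.
  by rewrite memNset /A/= ?lt_geF// ltr0_norm//=; lra.
rewrite (eq_Rintegral _ (g := fun x => h x * s x)); last first.
  by move=> x _; exact: hs.
rewrite fh//; apply: le_Rintegral => //.
- exact/integrable_mul_bounded/bounded_markov_op.
- exact: integrable_norm.
- move=> x _; rewrite (le_trans (ler_norm _))// normrM ler_piMr//.
  by apply: markov_op_le => //; case: bs.
Qed.

(** Applied to a difference, this is the uniqueness of the adjoint. *)
Lemma adjoint_pair0 h : L1 h -> adjoint_pair P T (fun=> 0) h ->
  {ae P, forall x, h x = 0}.
Proof.
move=> inth /(adjoint_pair_norm _ inth).
have int0 : L1 (fun=> 0) by exact/integrable_bounded_probability/bounded_cst.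
move=> /(_ int0); under [leRHS]eq_Rintegral do rewrite normr0.
rewrite Rintegral_cst// mul0r => h0.
have : (\int[P]_x `|(h x)%:E| = 0)%E.
  apply/eqP; rewrite eq_le integral_ge0// andbT.
  by have := EFin_Rintegral (integrable_norm inth) => /= <-; rewrite lee_fin.
have mh : measurable_fun setT (EFin \o h) by exact: measurable_int inth.
move/(ae_eq_integral_abs _ measurableT mh).
by apply: filterS => x /(_ I) [].
Qed.

(** The inequality [a * b <= (a ^+ 2 + b ^+ 2) / 2] between [f x] and [g y],
    averaged over [y]. *)
Lemma mul_markov_op_le f g x : bounded_mfun g ->
  f x * markov_op T g x <=
    2^-1 * (f x ^+ 2 + markov_op T (fun y => g y ^+ 2) x).
Proof.
move=> bg; have bg2 : bounded_mfun (fun y => g y ^+ 2) by exact: bounded_mul.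
have intk k : bounded_mfun k -> (T x).-integrable setT (EFin \o k).
  exact: kernel_integrable_bounded.
have b0 := bounded_cst Omega (0 : R).
have bfx := bounded_cst Omega (2^-1 * f x ^+ 2).
have -> : f x * markov_op T g x = \int[T x]_y (f x * g y + 0).
  by rewrite Rintegral_combination ?intk// Rintegral_cst// mul0r addr0.
have -> : 2^-1 * (f x ^+ 2 + markov_op T (fun y => g y ^+ 2) x) =
    \int[T x]_y (2^-1 * g y ^+ 2 + 2^-1 * f x ^+ 2).
  rewrite Rintegral_combination ?intk// Rintegral_cst//.
  by rewrite prob_kernel /= mulr1 mulrDr addrC.
apply: le_Rintegral => //; try (apply: intk; exact: bounded_combination).
by move=> y _; have := sqr_ge0 (f x - g y); rewrite sqrrB; lra.
Qed.

(** Let [t n] be [h] clipped at level [n].  Tested against itself it gives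
    E[(t n)^2] <= E[h * t n] = E[f * T (t n)] <= (E[f^2] + E[(t n)^2]) / 2,
    the last step by [mul_markov_op_le] and invariance.  The integral of
    (t n)^2 is finite, so E[(t n)^2] <= E[f^2], and Fatou's lemma concludes. *)
Lemma adjoint_pair_sqr f h : L1 f -> L1 h -> L1 (fun x => f x ^+ 2) ->
  adjoint_pair P T f h -> L1 (fun x => h x ^+ 2).
Proof.
move=> intf inth intf2 fh; have mh := integrable_mfun inth.
pose t n x := clip n (h x).
have bt n : bounded_mfun (t n) by exact: bounded_clip.
have bt2 n : bounded_mfun (fun x => t n x ^+ 2) by exact: bounded_mul.
have key n : \int[P]_x (t n x ^+ 2) <= \int[P]_x (f x ^+ 2).
  have : \int[P]_x (t n x ^+ 2) <= \int[P]_x (h x * t n x).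
    apply: le_Rintegral => //; first exact: integrable_bounded_probability.
      exact: integrable_mul_bounded.
    by move=> x _; exact: sqr_clip_le.
  rewrite fh//; set J := \int[P]_x (f x * _).
  have : J <= \int[P]_x
      (2^-1 * (1 * f x ^+ 2 + markov_op T (fun y => t n y ^+ 2) x) + 0).
    have i1 := integrable_combination 1 intf2
      (integrable_bounded_probability P (bounded_markov_op T (bt2 n))).
    apply: le_Rintegral => //.
    - exact/integrable_mul_bounded/bounded_markov_op.
    - apply: integrable_combination => //.
      exact/integrable_bounded_probability/bounded_cst.
    - by move=> x _; rewrite addr0 mul1r; exact: mul_markov_op_le.
  rewrite Rintegral_combination; last 2 first.
  - apply: integrable_combination => //.
    exact/integrable_bounded_probability/bounded_markov_op.
  - exact/integrable_bounded_probability/bounded_cst.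
  rewrite Rintegral_cst// mul0r addr0 Rintegral_combination//; last first.
    exact/integrable_bounded_probability/bounded_markov_op.
  by rewrite Rintegral_invariant//; lra.
apply/integrableP; split; first exact/measurable_EFinP/measurable_funX.
apply: (@le_lt_trans _ _ (\int[P]_x (f x ^+ 2))%:E); last exact: ltry.
have -> : (\int[P]_x `|(EFin \o (fun x => h x ^+ 2)%R) x| =
    \int[P]_x limn_einf (fun n => (t n x ^+ 2)%:E))%E.
  apply: eq_integral => x _; rewrite /= ger0_norm ?sqr_ge0//.
  have c : (t n x ^+ 2)%:E @[n --> \oo] --> (h x ^+ 2)%:E.
    apply: cvg_near_cst; apply: filterS (clip_near (h x)) => n.
    by rewrite /t => ->.
  rewrite is_cvg_limn_einfE; first by apply/esym/cvg_lim.
  by apply/cvg_ex; eexists; exact: c.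
have mt n : measurable_fun setT (fun x => (t n x ^+ 2)%:E).
  by apply/measurable_EFinP; case: (bt2 n).
apply: le_trans (fatou P measurableT mt _) _.
  by move=> n x _; rewrite lee_fin sqr_ge0.
have intE n : (\int[P]_x (t n x ^+ 2)%:E <= (\int[P]_x (f x ^+ 2))%:E)%E.
  rewrite -(EFin_Rintegral (integrable_bounded_probability P (bt2 n))).
  by rewrite lee_fin.
rewrite limn_einf_lim; apply: lime_le; first exact: is_cvg_einfs.
apply: nearW => n; apply: le_trans (intE n).
by rewrite /einfs /=; apply: ereal_inf_lbound; exists n => /=.
Qed.
End adjoint_pairs.

(** * Existence of the adjoint *)

Section dominated_clipping.
Context (d : measure_display) (Omega : measurableType d) (R : realType).
Variable mu : {measure set Omega -> \bar R}.
Implicit Types f g h : Omega -> R.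

Lemma cvg_integral_clip h g : measurable_fun setT h -> measurable_fun setT g ->
  mu.-integrable setT (EFin \o (h \* g)) ->
  (\int[mu]_x (h x * clip n (g x))%:E @[n --> \oo] -->
     \int[mu]_x (h x * g x)%:E)%E.
Proof.
move=> mh mg inthg.
have mt n : measurable_fun setT (fun x => clip n (g x)).
  by case: (bounded_clip n mg).
have [] // := @dominated_convergence _ _ _ mu setT measurableT
  (fun n x => (h x * clip n (g x))%:E) (fun x => (h x * g x)%:E)
  (fun x => `|h x * g x|%:E).
- by move=> n; apply/measurable_EFinP; exact: measurable_funM.
- by apply/measurable_EFinP; exact: measurable_funM.
- apply: nearW => x _; apply: cvg_near_cst.
  by apply: filterS (clip_near (g x)) => n ->.
- exact: integrable_norm inthg.
- apply: nearW => x n _; rewrite /= lee_fin !normrM ler_wpM2l//.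
  exact: clip_le_norm.
Qed.

End dominated_clipping.

Section adjoint_existence.
Context (d : measure_display) (Omega : measurableType d) (R : realType).
Variables (P : probability Omega R) (T : R.-pker Omega ~> Omega).
Implicit Types f g h : Omega -> R.
Hypothesis T_preserving : measure_preserving P T.

Let L1 f := P.-integrable setT (EFin \o f).

(** Clip [g] and let the level grow.  The inner integrals converge at every [x]
    for which [g] is integrable under [T x], that is almost everywhere by
    invariance, and the last hypothesis provides a dominating function. *)
Lemma adjoint_pair_extend f h g : L1 f -> L1 h -> L1 g ->
  adjoint_pair P T f h ->
  L1 (h \* g) ->
  (\int[P]_x (`|f x|%:E * \int[T x]_y `|g y|%:E) < +oo)%E ->
  (\int[P]_x (h x * g x)%:E = \int[P]_x (f x * markov_op T g x)%:E)%E.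
Proof.
move=> intf inth intg fh inthg dom.
have [mf mh mg] := And3 (integrable_mfun intf) (integrable_mfun inth)
  (integrable_mfun intg).
have mng : measurable_fun setT (fun y => `|g y|%:E).
  exact/measurable_EFinP/measurableT_comp.
have mTg : measurable_fun setT (fun x => \int[T x]_y `|g y|%:E)%E.
  by apply: measurable_kernel_integral => // y; rewrite lee_fin.
have Tg0 x : (0 <= \int[T x]_y `|g y|%:E)%E.
  by apply: integral_ge0 => y _; rewrite lee_fin.
have bt n : bounded_mfun (fun x => clip n (g x)) by exact: bounded_clip.
pose G x := (`|f x|%:E * \int[T x]_y `|g y|%:E)%E.
have mG : measurable_fun setT G.
  by apply: emeasurable_funM => //; exact/measurable_EFinP/measurableT_comp.
have G0 x : (0 <= G x)%E by rewrite /G mule_ge0 ?lee_fin.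
have intG : P.-integrable setT G.
  apply/integrableP; split => //.
  by under eq_integral do rewrite gee0_abs//.
have g_kernel_int : {ae P, forall x, (T x).-integrable setT (EFin \o g)}.
  have : P.-integrable setT (fun x => \int[T x]_y `|g y|%:E)%E.
    apply/integrableP; split => //.
    under eq_integral do rewrite gee0_abs//.
    rewrite (integral_invariant T_preserving) => //.
    by move/integrableP : intg => [].
  move/(integrable_ae measurableT); apply: filterS => x /(_ I) fin.
  apply/integrableP; split; first exact/measurable_EFinP.
  by rewrite ltey_eq fin.
have cvgT : (\int[P]_x (f x * markov_op T (fun y => clip n (g y)) x)%:E
    @[n --> \oo] --> \int[P]_x (f x * markov_op T g x)%:E)%E.
  have mfT k : measurable_fun setT k ->
      measurable_fun setT (fun x => (f x * markov_op T k x)%:E).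
    move=> mk; apply/measurable_EFinP; apply: measurable_funM => //.
    exact: measurable_markov_op.
  have [] // := @dominated_convergence _ _ _ P setT measurableT
    (fun n x => (f x * markov_op T (fun y => clip n (g y)) x)%:E)
    (fun x => (f x * markov_op T g x)%:E) G.
  - by move=> n; apply: mfT; case: (bt n).
  - exact: mfT.
  - apply: filterS g_kernel_int => x ig _.
    under eq_fun do rewrite EFinM EFin_Rintegral ?kernel_integrable_bounded//.
    rewrite EFinM EFin_Rintegral//; apply: cvgeZl => //.
    have := @cvg_integral_clip _ _ _ (T x) (cst 1) g.
    have -> : EFin \o (cst 1 \* g) = EFin \o g.
      by apply/funext => y /=; rewrite mul1r.
    move=> /(_ (measurable_cst _) mg ig).
    under eq_fun do under eq_integral do rewrite mul1r.
    by under [X in _ --> X]eq_integral do rewrite mul1r.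
  - apply: nearW => x n _; rewrite EFinM abseM lee_pmul ?abse_ge0//.
    rewrite EFin_Rintegral ?kernel_integrable_bounded//.
    have mtn : measurable_fun setT (fun y => (clip n (g y))%:E).
      by apply/measurable_EFinP; case: (bt n).
    apply: le_trans (le_abse_integral _ measurableT mtn) _.
    apply: ge0_le_integral => //; first exact: measurableT_comp.
    by move=> y _; rewrite lee_fin; exact: clip_le_norm.
have := cvg_integral_clip mh mg inthg.
rewrite (_ : (fun n => \int[P]_x (h x * clip n (g x))%:E)%E =
  (fun n => \int[P]_x (f x * markov_op T (fun y => clip n (g y)) x)%:E)%E).
  by move=> c; apply: cvg_unique c cvgT.
apply/funext => n.
rewrite -EFin_Rintegral ?fh ?EFin_Rintegral//; last first.
  exact: integrable_mul_bounded.
exact/integrable_mul_bounded/bounded_markov_op.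
Qed.

Lemma Lfun2P f : f \in Lfun P 2%:E <->
  measurable_fun setT f /\ L1 (fun x => f x ^+ 2).
Proof.
split=> [f2|[mf f2]].
  split; last exact: Lfun2_integrable_sqr f2.
  by move: f2 => /andP[]; rewrite inE.
apply/andP; split; rewrite inE//= /finite_norm unlock /Lnorm poweR_lty//.
move/integrableP : f2 => [_]; apply: le_lt_trans.
by under eq_integral do rewrite poweR_EFin powR_mulrn// -normrX.
Qed.

(** The operator picks an adjoint of each integrable function.  It is linear
    almost everywhere because the difference of the two sides is an adjoint of
    zero, and it contracts both norms. *)
Lemma is_adjoint_ex : exists S, is_adjoint P T S.
Proof.
have /choice[S SP] : forall f, exists h, L1 f -> L1 h /\ adjoint_pair P T f h.
  move=> f; have [intf|nintf] := pselect (L1 f); last by exists f.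
  by have [h ? ?] := adjoint_pair_ex T_preserving intf; exists h.
exists S; split.
- move=> f g f2 g2.
  have [mf intf2] := (Lfun2P f).1 f2; have [mg intg2] := (Lfun2P g).1 g2.
  have L21 k : k \in Lfun P 2%:E -> L1 k.
    move=> k2; apply/Lfun1_integrable/Lfun_subset12 => //.
    exact: fin_num_measure.
  have [intf intg] := (L21 _ f2, L21 _ g2).
  have [intSf fSf] := SP f intf; have mSf := integrable_mfun intSf.
  have Sf2 : S f \in Lfun P 2%:E.
    apply/Lfun2P; split => //.
    exact: (adjoint_pair_sqr T_preserving intf intSf intf2 fSf).
  split=> //; rewrite unlock.
  under [in RHS]eq_integral do rewrite /= mulrC.
  apply: adjoint_pair_extend => //.
    exact/Lfun1_integrable/Lfun2_mul_Lfun1.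
  have mg2 : measurable_fun setT (fun y => (g y ^+ 2)%:E).
    exact/measurable_EFinP/measurable_funX.
  have mf2 : measurable_fun setT (fun y => (f y ^+ 2)%:E).
    exact/measurable_EFinP/measurable_funX.
  have mTg2 : measurable_fun setT (fun x => \int[T x]_y (g y ^+ 2)%:E)%E.
    by apply: measurable_kernel_integral => // y; rewrite lee_fin sqr_ge0.
  have mng : measurable_fun setT (fun y => `|g y|%:E).
    exact/measurable_EFinP/measurableT_comp.
  (* |f x| |g y| <= f x ^ 2 + g y ^ 2 dominates the pairing. *)
  apply: (@le_lt_trans _ _
    (\int[P]_x ((f x ^+ 2)%:E + \int[T x]_y (g y ^+ 2)%:E)))%E.
    apply: ge0_le_integral => //.
    + move=> x _; rewrite mule_ge0 ?lee_fin//.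
      by apply: integral_ge0 => y _; rewrite lee_fin.
    + apply: emeasurable_funM; first exact/measurable_EFinP/measurableT_comp.
      by apply: measurable_kernel_integral => // y; rewrite lee_fin.
    + exact: emeasurable_funD.
    + move=> x _.
      have -> : ((f x ^+ 2)%:E + \int[T x]_y (g y ^+ 2)%:E =
          \int[T x]_y ((f x ^+ 2)%:E + (g y ^+ 2)%:E))%E.
        rewrite ge0_integralD//; last 2 first.
          by move=> y _; rewrite lee_fin sqr_ge0.
          by move=> y _; rewrite lee_fin sqr_ge0.
        by rewrite integral_cst// prob_kernel mule1.
      rewrite -ge0_integralZl ?lee_fin//.
      apply: ge0_le_integral => //.
      * exact: measurable_funeM.
      * exact: emeasurable_funD.
      * move=> y _; rewrite -EFinM -EFinD lee_fin.
        rewrite -(real_normK (num_real (f x))).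
        rewrite -(real_normK (num_real (g y))).
        have := sqr_ge0 (`|f x| - `|g y|); rewrite sqrrB.
        have := sqr_ge0 (`|f x|); have := sqr_ge0 (`|g y|); lra.
  rewrite ge0_integralD//; last 2 first.
  + by move=> x _; rewrite lee_fin sqr_ge0.
  + by move=> x _; apply: integral_ge0 => y _; rewrite lee_fin sqr_ge0.
  rewrite (integral_invariant T_preserving) => //; last first.
    by move=> x; rewrite lee_fin sqr_ge0.
  rewrite -(EFin_Rintegral intf2) -(EFin_Rintegral intg2) -EFinD.
  exact: ltry.
- by move=> f /Lfun1_integrable/SP[? _]; exact/Lfun1_integrable.
- move=> a f g /Lfun1_integrable intf /Lfun1_integrable intg.
  have [iSf fSf] := SP f intf; have [iSg gSg] := SP g intg.
  have intfg := integrable_combination a intf intg.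
  have [iSfg fgSfg] := SP _ intfg.
  have iS := integrable_combination a iSf iSg.
  have pS := adjoint_pair_combination a intf intg iSf iSg fSf gSg.
  have := adjoint_pair_combination (-1) intfg intfg iS iSfg pS fgSfg.
  have -> : (fun x => -1 * (a * f x + g x) + (a * f x + g x)) = (fun=> 0).
    by apply/funext => x; rewrite mulN1r addNr.
  move/adjoint_pair0 => /(_ (integrable_combination (-1) iS iSfg)).
  by apply: filterS => x /eqP; rewrite mulN1r addrC subr_eq0 => /eqP.
- exists 1 => f /Lfun1_integrable intf; have [iSf fSf] := SP f intf.
  rewrite mul1e !Lnorm1.
  rewrite -[leLHS](EFin_Rintegral (integrable_norm iSf)).
  rewrite -[leRHS](EFin_Rintegral (integrable_norm intf)) lee_fin.
  exact: (adjoint_pair_norm intf iSf fSf).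
Qed.

Lemma adjoint_is_adjoint : is_adjoint P T (adjoint P T).
Proof. have [S SP] := is_adjoint_ex; exact: xgetI SP. Qed.

End adjoint_existence.

(** * Pairing with bounded functions *)

Section adjoint_duality.
Context (d : measure_display) (Omega : measurableType d) (R : realType).
Variables (P : probability Omega R) (T : R.-pker Omega ~> Omega).
Implicit Types f g h : Omega -> R.
Hypothesis T_preserving : measure_preserving P T.

Let L1 f := P.-integrable setT (EFin \o f).

Lemma Rintegral_ae_eq f g : measurable_fun setT f -> measurable_fun setT g ->
  {ae P, forall x, f x = g x} -> \int[P]_x f x = \int[P]_x g x.
Proof.
move=> mf mg fg; congr fine; apply: ae_eq_integral => //.
- exact/measurable_EFinP.
- exact/measurable_EFinP.
- by apply: filterS fg => x ->.
Qed.

Lemma Rintegral_mul_bounded_le f g K : L1 f -> measurable_fun setT g ->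
  (forall x, `|g x| <= K) -> `|\int[P]_x (f x * g x)| <= K * \int[P]_x `|f x|.
Proof.
move=> intf mg gK; have bg : bounded_mfun g by split => //; exists K.
have intfg := integrable_mul_bounded intf bg.
rewrite (le_trans (le_normr_Rintegral _ intfg))//.
rewrite -RintegralZl//; last exact: integrable_norm.
apply: le_Rintegral => //; first exact: integrable_norm intfg.
- exact: integrableZl (integrable_norm intf).
- by move=> x _; rewrite normrM mulrC ler_wpM2r.
Qed.

(** Clipped versions of [f] are square integrable, where the pairing is part of
    the definition.  They converge to [f] in mean, and both sides depend
    continuously on [f] for that norm. *)
Lemma is_adjoint_pair S f : is_adjoint P T S -> L1 f ->
  adjoint_pair P T f (S f).
Proof.
move=> [SL2 SL1 Slin [C SC]] intf g bg; have [mg [K gK]] := bg.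
have mf := integrable_mfun intf.
have intS k : L1 k -> L1 (S k).
  by move=> /Lfun1_integrable/SL1/Lfun1_integrable.
have K0 : 0 <= K by rewrite (le_trans _ (gK point)).
pose t n x := clip n (f x); pose r n x := -1 * t n x + f x.
have bt n : bounded_mfun (t n) by exact: bounded_clip.
have intt n : L1 (t n) by exact: integrable_bounded_probability.
have intr n : L1 (r n) by exact: (integrable_combination (-1) (intt n) intf).
have bTg := bounded_markov_op T bg.
have dual_t n :
    \int[P]_x (S (t n) x * g x) = \int[P]_x (t n x * markov_op T g x).
  have L2 k : bounded_mfun k -> k \in Lfun P 2%:E.
    by apply: bounded_Lfun; rewrite lee1n.
  have [_] := SL2 _ _ (L2 _ (bt n)) (L2 _ bg).
  rewrite unlock => /(congr1 fine) E; rewrite [LHS]E.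
  by apply: eq_Rintegral => x _; rewrite mulrC.
pose D := \int[P]_x (S f x * g x) - \int[P]_x (f x * markov_op T g x).
have err n : D =
    \int[P]_x (S (r n) x * g x) - \int[P]_x (r n x * markov_op T g x).
  have -> : \int[P]_x (S (r n) x * g x) =
      \int[P]_x (-1 * (S (t n) x * g x) + S f x * g x).
    apply: Rintegral_ae_eq.
    - by apply: measurable_funM => //; exact: integrable_mfun (intS _ (intr n)).
    - by apply/integrable_mfun/integrable_combination;
        apply: integrable_mul_bounded => //; apply: intS.
    - have := Slin (-1) _ _ ((Lfun1_integrable _ _).2 (intt n))
        ((Lfun1_integrable _ _).2 intf).
      by apply: filterS => x ->; rewrite mulrDl mulrA.
  have -> : \int[P]_x (r n x * markov_op T g x) =
      \int[P]_x (-1 * (t n x * markov_op T g x) + f x * markov_op T g x).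
    by apply: eq_Rintegral => x _; rewrite /r mulrDl mulrA.
  rewrite !Rintegral_combination; try
    (by apply: integrable_mul_bounded => //; apply: intS).
  2: exact: integrable_mul_bounded (intt n) bTg.
  by rewrite dual_t /D; lra.
have bound n : `|D| <= K * (C + 1) * \int[P]_x `|r n x|.
  rewrite (err n) (le_trans (ler_normB _ _))// mulrDr mulr1 mulrDl lerD//.
    apply: le_trans (Rintegral_mul_bounded_le (intS _ (intr n)) mg gK) _.
    rewrite -mulrA ler_wpM2l//.
    have := SC _ ((Lfun1_integrable _ _).2 (intr n)); rewrite !Lnorm1.
    have := EFin_Rintegral (integrable_norm (intS _ (intr n))) => /= <-.
    by have := EFin_Rintegral (integrable_norm (intr n)) => /= <-.
  apply: Rintegral_mul_bounded_le => //; first by case: bTg.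
  by move=> x; exact: markov_op_le.
have r0 : (\int[P]_x `|r n x|%:E @[n --> \oo] --> 0)%E.
  have mr n : measurable_fun setT (r n) := integrable_mfun (intr n).
  have [] // := @dominated_convergence _ _ _ P setT measurableT
    (fun n x => `|r n x|%:E) (fun=> 0%E) (fun x => `|f x|%:E).
  - by move=> n; apply/measurable_EFinP; exact: measurableT_comp.
  - apply: nearW => x _; apply: cvg_near_cst.
    apply: filterS (clip_near (f x)) => n.
    by rewrite /r /t => ->; rewrite mulN1r addNr normr0.
  - exact: integrable_norm intf.
  - apply: nearW => x n _; rewrite /= lee_fin normr_id /r mulN1r addrC.
    exact: sub_clip_le.
  - by move=> _ _; rewrite integral0.
suff : `|D| <= 0 by rewrite normr_le0 subr_eq0 => /eqP.
rewrite -lee_fin; have c : ((K * (C + 1))%:E * \int[P]_x `|r n x|%:E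
    @[n --> \oo] --> (K * (C + 1))%:E * 0)%E by exact: cvgeZl.
rewrite -[leRHS](mule0 (K * (C + 1))%:E) -(cvg_lim _ c)//.
apply: lime_ge; first by apply/cvg_ex; eexists; exact: c.
apply: nearW => n.
have := EFin_Rintegral (integrable_norm (intr n)) => /= <-.
by rewrite -EFinM lee_fin.
Qed.

Lemma adjoint_pair_adjoint f : L1 f -> adjoint_pair P T f (adjoint P T f).
Proof. by move=> intf; apply/is_adjoint_pair/intf/adjoint_is_adjoint. Qed.

Lemma adjoint_integrable f : L1 f -> L1 (adjoint P T f).
Proof.
have [_ SL1 _ _] := adjoint_is_adjoint T_preserving.
by move=> /Lfun1_integrable/SL1/Lfun1_integrable.
Qed.

Lemma adjoint_pair_mass f h : L1 f -> L1 h -> adjoint_pair P T f h ->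
  \int[P]_x h x = \int[P]_x f x.
Proof.
move=> intf inth /(_ (cst 1) (bounded_cst _ _)).
rewrite (eq_Rintegral _ (g := h)); last by move=> x _; rewrite mulr1.
move=> ->; apply: eq_Rintegral => x _.
by rewrite /markov_op Rintegral_cst// prob_kernel !mulr1.
Qed.

(** Test against the indicator of the set where [h] is negative. *)
Lemma adjoint_pair_ge0 f h : (forall x, 0 <= f x) -> L1 f -> L1 h ->
  adjoint_pair P T f h -> {ae P, forall x, 0 <= h x}.
Proof.
move=> f0 intf inth fh; have mh := integrable_mfun inth.
pose A := [set x | h x < 0].
have mA : measurable A.
  rewrite -[A]setTI; have -> : A = h @^-1` `]-oo, 0[.
    by apply/seteqP; split => x /=; rewrite in_itv /=.
  exact: mh.
have bA := bounded_indic R mA.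
have hA_ge0 : 0 <= \int[P]_x (h x * \1_A x).
  rewrite fh//; apply: Rintegral_ge0 => x _; rewrite mulr_ge0//.
  by apply: Rintegral_ge0 => y _; rewrite indicE.
have hA x : h x * \1_A x <= 0.
  rewrite indicE; case: (boolP (x \in A)) => [|_]; last by rewrite mulr0.
  by move=> /set_mem/ltW; rewrite mulr1.
have inthA := integrable_mul_bounded inth bA.
have : (\int[P]_x `|(h x * \1_A x)%:E| = 0)%E.
  apply/eqP; rewrite eq_le integral_ge0// andbT.
  have := EFin_Rintegral (integrable_norm inthA) => /= <-; rewrite lee_fin.
  rewrite (eq_Rintegral _ (g := fun x => -1 * (h x * \1_A x))); last first.
    by move=> x _; rewrite ler0_norm// mulN1r.
  by rewrite RintegralZl// mulN1r oppr_le0.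
have mhA : measurable_fun setT (fun x => (h x * \1_A x)%:E).
  exact: measurable_int inthA.
move/(ae_eq_integral_abs _ measurableT mhA).
apply: filterS => x /(_ I) []; rewrite indicE.
case: (boolP (x \in A)) => [_|/negP xA _].
  by rewrite mulr1 => ->.
by rewrite leNgt; apply/negP => hx; apply: xA; exact: mem_set.
Qed.

End adjoint_duality.

(** * Entropy and the Gibbs variational principle *)

Section young.
Context (R : realType).

(** Young's inequality for the conjugate pair [x ln x - x] and [exp t]: it is
    [1 + s <= exp s] at [s = t - ln x], multiplied by [x]. *)
Lemma mulr_ln_young (x t : R) : 0 <= x -> x * t <= x * ln x - x + expR t.
Proof.
rewrite le_eqVlt => /predU1P[<-|x0].
  by rewrite !mul0r subr0 add0r expR_ge0.
have : x * (1 + (t - ln x)) <= x * expR (t - ln x).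
  by rewrite ler_pM2l// expR_ge1Dx.
rewrite expRB lnK// mulrCA divff ?gt_eqF// mulr1; lra.
Qed.

Lemma mulr_ln_ge (x : R) : 0 <= x -> -1 <= x * ln x.
Proof. by move=> x0; have := mulr_ln_young 0 x0; rewrite expR0; lra. Qed.

End young.

Section entropy.
Context (d : measure_display) (Omega : measurableType d) (R : realType).
Variable (P : probability Omega R).
Implicit Types f g phi : Omega -> R.

Let L1 f := P.-integrable setT (EFin \o f).

Lemma Rintegral_probability_cst (c : R) : \int[P]_x c = c.
Proof.
by have := expectation_cst P c; rewrite unlock => /(congr1 fine).
Qed.

Lemma bounded_expR phi : bounded_mfun phi ->
  bounded_mfun (fun x => expR (phi x)).
Proof.
move=> [mphi [K phiK]]; split; first exact: measurableT_comp.
exists (expR K) => x; rewrite ger0_norm ?expR_ge0// ler_expR.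
exact: le_trans (ler_norm _) (phiK x).
Qed.

Lemma Rintegral_expR_gt0 phi : bounded_mfun phi ->
  0 < \int[P]_x expR (phi x).
Proof.
move=> bphi; have [_ [K phiK]] := bphi.
apply: (@lt_le_trans _ _ (\int[P]_x expR (- K))).
  by rewrite Rintegral_probability_cst expR_gt0.
apply: le_Rintegral => //.
- exact/integrable_bounded_probability/bounded_cst.
- exact/integrable_bounded_probability/bounded_expR.
- by move=> x _; rewrite ler_expR; have := phiK x; rewrite ler_norml => /andP[].
Qed.

(** Comparing positive and negative parts separately covers infinite integrals,
    as is necessary for an infinite entropy. *)
Lemma le_integral_measurable (u w : Omega -> \bar R) :
  measurable_fun setT u -> measurable_fun setT w ->
  (forall x, u x <= w x)%E -> (\int[P]_x u x <= \int[P]_x w x)%E.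
Proof.
move=> mu mw uw; rewrite [leLHS]integralE [leRHS]integralE.
apply: leeB; apply: ge0_le_integral => //.
- exact: measurable_funepos.
- exact: measurable_funepos.
- by move=> x _; rewrite !funeposE ge_max !le_max uw lexx orbT.
- exact: measurable_funeneg.
- exact: measurable_funeneg.
- by move=> x _; rewrite !funenegE ge_max !le_max leeN2 uw lexx orbT.
Qed.

Lemma measurable_mul_ln f : measurable_fun setT f ->
  measurable_fun setT (fun x => f x * ln (f x)).
Proof.
by move=> mf; apply: measurable_funM => //; exact: measurableT_comp.
Qed.

Lemma EntE f : L1 f -> 0 <= \int[P]_x f x ->
  Ent P f = (\int[P]_x (f x * ln (f x))%:E -
    (\int[P]_x f x * ln (\int[P]_x f x))%:E)%E.
Proof.
move=> intf; rewrite /Ent unlock -(EFin_Rintegral intf).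
rewrite le_eqVlt => /predU1P[<-|m0]; first by rewrite mul0e mul0r.
by rewrite lne_EFin.
Qed.

Lemma Ent_ae_eq f g : measurable_fun setT f -> measurable_fun setT g ->
  {ae P, forall x, f x = g x} -> Ent P f = Ent P g.
Proof.
move=> mf mg fg; rewrite /Ent unlock.
have -> : (\int[P]_x (f x)%:E = \int[P]_x (g x)%:E)%E.
  apply: ae_eq_integral => //; [exact/measurable_EFinP..|].
  by apply: filterS fg => x ->.
congr (_ - _)%E; apply: ae_eq_integral => //.
- exact/measurable_EFinP/measurable_mul_ln.
- exact/measurable_EFinP/measurable_mul_ln.
- by apply: filterS fg => x ->.
Qed.

Lemma mass0_ae f : (forall x, 0 <= f x) -> L1 f -> \int[P]_x f x = 0 ->
  {ae P, forall x, f x = 0}.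
Proof.
move=> f0 intf m0; have mf : measurable_fun setT (EFin \o f).
  exact: measurable_int intf.
have : (\int[P]_x `|(f x)%:E| = 0)%E.
  transitivity (\int[P]_x f x)%:E; last by rewrite m0.
  rewrite EFin_Rintegral//.
  by apply: eq_integral => x _; rewrite gee0_abs// lee_fin.
move/(ae_eq_integral_abs _ measurableT mf).
by apply: filterS => x /(_ I) [].
Qed.

Lemma Ent_mass0 f : (forall x, 0 <= f x) -> L1 f -> \int[P]_x f x = 0 ->
  Ent P f = 0%E.
Proof.
move=> f0 intf m0; have mf := integrable_mfun intf.
rewrite (Ent_ae_eq mf (measurable_cst (0 : R)) (mass0_ae f0 intf m0)).
rewrite /Ent unlock; under eq_integral do rewrite mul0r.
by rewrite integral0 mul0e sube0.
Qed.

(** Integrate Young's inequality for [phi - a].  The best shift [a] is the one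
    for which [exp (phi - a)] has the same integral as [f]. *)
Lemma gibbs f phi : (forall x, 0 <= f x) -> L1 f -> bounded_mfun phi ->
  ((\int[P]_x (f x * phi x) - \int[P]_x f x * ln (\int[P]_x expR (phi x)))%:E
    <= Ent P f)%E.
Proof.
move=> f0 intf bphi; have mf := integrable_mfun intf; have [mphi _] := bphi.
have : 0 <= \int[P]_x f x by exact: Rintegral_ge0.
rewrite le_eqVlt => /predU1P[/esym m0|].
  rewrite Ent_mass0// m0 mul0r subr0 lee_fin.
  rewrite (Rintegral_ae_eq (g := cst 0)) ?Rintegral_cst ?mul0r//.
    exact: measurable_funM.
  by apply: filterS (mass0_ae f0 intf m0) => x ->; rewrite mul0r.
have Z0 := Rintegral_expR_gt0 bphi.
set m := \int[P]_x f x; set Z := \int[P]_x expR (phi x) => m0.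
pose a := ln Z - ln m.
have bphia : bounded_mfun (fun x => 1 * phi x + - a).
  exact: bounded_combination bphi (bounded_cst _ _).
have intfphi := integrable_mul_bounded intf bphi.
have inte := integrable_bounded_probability P (bounded_expR bphia).
pose u x := (1 - a) * f x + (-1 * expR (1 * phi x + - a) + f x * phi x).
have intu : L1 u.
  by apply: integrable_combination => //; exact: integrable_combination.
have uE : \int[P]_x u x = \int[P]_x (f x * phi x) - a * m.
  rewrite Rintegral_combination//; last exact: integrable_combination.
  rewrite Rintegral_combination//.
  have -> : \int[P]_x expR (1 * phi x + - a) = m.
    transitivity (\int[P]_x (m / Z * expR (phi x))).
      apply: eq_Rintegral => x _.
      by rewrite mul1r expRD expRN expRB !lnK// invf_div mulrC.
    rewrite RintegralZl//; last first.
      exact/integrable_bounded_probability/bounded_expR.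
    by rewrite -/Z divfK// gt_eqF.
  by rewrite -/m; lra.
rewrite EntE// ?(ltW m0)// -/m.
have -> : \int[P]_x (f x * phi x) - m * ln Z = \int[P]_x u x - m * ln m.
  by rewrite uE /a; lra.
rewrite EFinB; apply: leeB => //.
rewrite (EFin_Rintegral intu); apply: le_integral_measurable.
- exact: measurable_int intu.
- exact/measurable_EFinP/measurable_mul_ln.
- move=> x; rewrite lee_fin /u mul1r.
  by have := mulr_ln_young (phi x - a) (f0 x); lra.
Qed.

(** The density proportional to [exp F] is the case of equality in [gibbs]. *)
Lemma Ent_gibbs_density F : bounded_mfun F ->
  let Z := \int[P]_x expR (F x) in
  let f x := Z^-1 * expR (F x) in
  [/\ LlogL P f, \int[P]_x f x = 1 &
      Ent P f = (\int[P]_x (f x * F x) - ln Z)%:E].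
Proof.
move=> bF Z f; have Z0 : 0 < Z := Rintegral_expR_gt0 bF.
have beF := bounded_expR bF.
have bf : bounded_mfun f.
  have := bounded_combination Z^-1 beF (bounded_cst Omega 0).
  by under eq_fun do rewrite addr0.
have intf := integrable_bounded_probability P bf.
have lnf x : ln (f x) = F x - ln Z.
  by rewrite lnM ?posrE ?expR_gt0 ?invr_gt0// lnV ?posrE// expRK addrC.
have f1 : \int[P]_x f x = 1.
  rewrite RintegralZl//; last exact: integrable_bounded_probability.
  by rewrite mulVf// gt_eqF.
have bl : bounded_mfun (fun x => f x * ln (f x)).
  apply: bounded_mul => //; under eq_fun do rewrite lnf -[F _]mul1r.
  exact: bounded_combination bF (bounded_cst _ _).
split => //.
- split; first by case: bf.
  + by move=> x; rewrite mulr_ge0 ?expR_ge0// invr_ge0 ltW.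
  + rewrite unlock.
    have intl := integrable_norm (integrable_bounded_probability P bl).
    by have /= <- := EFin_Rintegral intl; rewrite ltry.
- rewrite EntE ?f1// ln1 mulr0 sube0.
  rewrite -(EFin_Rintegral (integrable_bounded_probability P bl)); congr EFin.
  transitivity (\int[P]_x (- ln Z * f x + f x * F x)).
    by apply: eq_Rintegral => x _; rewrite lnf; lra.
  rewrite Rintegral_combination ?f1//; last exact: integrable_mul_bounded.
  by rewrite mulr1 addrC.
Qed.

(** Young's inequality at [t = 1] bounds [f] by [f ln f + exp 1]. *)
Lemma LlogL_integrable f : LlogL P f ->
  L1 f /\ L1 (fun x => f x * ln (f x)).
Proof.
move=> [mf f0 flnf]; have mlnf := measurable_mul_ln mf.
have intl : L1 (fun x => f x * ln (f x)).
  by move: flnf; rewrite unlock => flnf; apply/integrableP; split => //;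
    exact/measurable_EFinP.
split=> //.
apply: (@integrable_dominated _ _ _ _ _
  (fun x => 1 * (f x * ln (f x)) + expR 1)) => //.
  move=> x; rewrite ger0_norm//.
  by have := mulr_ln_young 1 (f0 x); have := f0 x; rewrite mulr1; lra.
apply: integrable_combination => //.
exact/integrable_bounded_probability/bounded_cst.
Qed.

End entropy.

(** * The Brascamp-Lieb inequality in logarithmic form *)

Section sums.
Context (d : measure_display) (Omega : measurableType d) (R : realType).
Variables (mu : {measure set Omega -> \bar R}).
Context (I : Type).
Implicit Types (F : I -> Omega -> R) (c : I -> R).

Lemma bounded_sum s c F : (forall i, bounded_mfun (F i)) ->
  bounded_mfun (fun x => \sum_(i <- s) c i * F i x).
Proof.
move=> bF; elim: s => [|i s IH].
  by under eq_fun do rewrite big_nil; exact: bounded_cst.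
by under eq_fun do rewrite big_cons; exact: bounded_combination.
Qed.

Lemma integrable_lincomb s c F :
  (forall i, mu.-integrable setT (EFin \o F i)) ->
  mu.-integrable setT (EFin \o (fun x => \sum_(i <- s) c i * F i x)).
Proof.
move=> intF; elim: s => [|i s IH].
  rewrite (_ : EFin \o _ = cst 0%E); first exact: integrable0.
  by apply/funext => x; rewrite /= big_nil.
rewrite (_ : EFin \o _ =
  EFin \o (fun x => c i * F i x + \sum_(j <- s) c j * F j x)).
  exact: integrable_combination.
by apply/funext => x; rewrite /= big_cons.
Qed.

Lemma Rintegral_lincomb s c F :
  (forall i, mu.-integrable setT (EFin \o F i)) ->
  \int[mu]_x (\sum_(i <- s) c i * F i x) =
  \sum_(i <- s) c i * \int[mu]_x F i x.
Proof.
move=> intF; elim: s => [|i s IH].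
  rewrite big_nil /Rintegral; under eq_integral do rewrite big_nil.
  by rewrite integral0.
rewrite big_cons -IH -Rintegral_combination//; last exact: integrable_lincomb.
by apply: eq_Rintegral => x _; rewrite big_cons.
Qed.

End sums.

Section brascamp_lieb.
Context (d : measure_display) (Omega : measurableType d) (R : realType).
Variables (P : probability Omega R) (M : nat).
Variables (T : 'I_M -> R.-pker Omega ~> Omega) (c : 'I_M -> R).
Implicit Types (phi psi : 'I_M -> Omega -> R).

Let L1 f := P.-integrable setT (EFin \o f).

(** The exponent of the integrand on the left of the Brascamp-Lieb inequality,
    dual to the family of adjoints. *)
Definition log_integrand phi x := \sum_(i < M) c i * markov_op (T i) (phi i) x.

Lemma bounded_log_integrand phi : (forall i, bounded_mfun (phi i)) ->
  bounded_mfun (log_integrand phi).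
Proof. by move=> bphi; apply: bounded_sum => i; exact: bounded_markov_op. Qed.

Lemma Rintegral_log_integrand f phi :
  L1 f -> (forall i, bounded_mfun (phi i)) ->
  \int[P]_x (f x * log_integrand phi x) =
  \sum_(i < M) c i * \int[P]_x (f x * markov_op (T i) (phi i) x).
Proof.
move=> intf bphi; rewrite -Rintegral_lincomb.
  apply: eq_Rintegral => x _; rewrite mulr_sumr.
  by apply: eq_bigr => i _; rewrite mulrCA.
by move=> i; exact/integrable_mul_bounded/bounded_markov_op.
Qed.

Definition brascamp_lieb phi : Prop :=
  ('E_P[fun x => (\prod_(i < M) expR (c i * markov_op (T i) (phi i) x))%R]
    <= \prod_(i < M) 'E_P[fun x => expR (phi i x)] `^ (c i))%E.

Lemma brascamp_lieb_ln phi : (forall i, bounded_mfun (phi i)) ->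
  brascamp_lieb phi <->
  ln (\int[P]_x expR (log_integrand phi x)) <=
    \sum_(i < M) c i * ln (\int[P]_x expR (phi i x)).
Proof.
move=> bphi; rewrite /brascamp_lieb unlock.
have bF := bounded_log_integrand bphi.
under eq_integral do rewrite -expR_sum.
rewrite -(EFin_Rintegral (integrable_bounded_probability P (bounded_expR bF))).
under eq_bigr do rewrite -(EFin_Rintegral
  (integrable_bounded_probability P (bounded_expR (bphi _)))) poweR_EFin.
rewrite prodEFin lee_fin -ler_expR lnK ?posrE ?Rintegral_expR_gt0// expR_sum.
rewrite (eq_bigr (fun i => expR (c i * ln (\int[P]_x expR (phi i x)))))//.
by move=> i _; rewrite /powR gt_eqF// Rintegral_expR_gt0.
Qed.

Hypothesis T_preserving : forall i, measure_preserving P (T i).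

(** This reduces essentially bounded functions to bounded ones: a null set on
    which [phi i] is changed is not seen by almost every [T i x]. *)
Lemma brascamp_lieb_ae_eq phi psi :
  (forall i, measurable_fun setT (phi i)) ->
  (forall i, measurable_fun setT (psi i)) ->
  (forall i, {ae P, forall x, phi i x = psi i x}) ->
  brascamp_lieb psi -> brascamp_lieb phi.
Proof.
move=> mphi mpsi phipsi; rewrite /brascamp_lieb unlock.
have mprod k : (forall i, measurable_fun setT (k i)) -> measurable_fun setT
    (fun x => (\prod_(i < M) expR (c i * markov_op (T i) (k i) x))%:E).
  move=> mk; apply/measurable_EFinP; under eq_fun do rewrite -expR_sum.
  apply: measurableT_comp => //; apply: measurable_sum => i.
  by apply: measurable_funM => //; exact: measurable_markov_op.
have -> : (\int[P]_x (\prod_(i < M) expR (c i * markov_op (T i) (phi i) x))%:E =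
    \int[P]_x (\prod_(i < M) expR (c i * markov_op (T i) (psi i) x))%:E)%E.
  apply: ae_eq_integral => //; [exact: mprod..|].
  have : {ae P, forall x, forall i,
      markov_op (T i) (phi i) x = markov_op (T i) (psi i) x}.
    by apply: filter_forall => i; exact: markov_op_ae_eq.
  by apply: filterS => x E _; congr EFin; apply: eq_bigr => i _; rewrite E.
suff phipsiE i : (\int[P]_x (expR (phi i x))%:E =
    \int[P]_x (expR (psi i x))%:E)%E.
  by under [in X in _ -> X]eq_bigr do rewrite phipsiE.
apply: ae_eq_integral => //; try exact/measurable_EFinP/measurableT_comp.
by apply: filterS (phipsi i) => x ->.
Qed.

Lemma Lfuny_bounded (g : Omega -> R) : g \in Lfun P +oo%E ->
  exists2 g', bounded_mfun g' & {ae P, forall x, g x = g' x}.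
Proof.
move=> /andP[]; rewrite inE /= => mg; rewrite inE /= /finite_norm unlock /Lnorm.
rewrite ifT; last first.
  exact: (eq_ind_r (fun m => 0 < m)%E lte01 (probability_setT P)).
move=> /ess_supr_bounded[K gK]; pose n := (Num.truncn K).+1.
exists (fun x => clip n (g x)); first exact: bounded_clip.
apply: filterS gK => x gxK; rewrite clip_id//.
by rewrite (le_trans gxK)// ltW// truncnS_gt.
Qed.

End brascamp_lieb.

(** * Approximation of the entropy by bounded test functions *)

Section ent_adjoint.
Context (d : measure_display) (Omega : measurableType d) (R : realType).
Variables (P : probability Omega R) (T : R.-pker Omega ~> Omega).
Hypothesis T_preserving : measure_preserving P T.
Implicit Types (f g phi : Omega -> R).

Let L1 f := P.-integrable setT (EFin \o f).

(** An adjoint of [f] is nonnegative only almost everywhere; its positive part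
    is nonnegative everywhere and has the same entropy. *)
Lemma adjoint_nneg_version f : (forall x, 0 <= f x) -> L1 f ->
  exists g, [/\ forall x, 0 <= g x, L1 g, adjoint_pair P T f g,
    \int[P]_x g x = \int[P]_x f x & Ent P (adjoint P T f) = Ent P g].
Proof.
move=> f0 intf; have intS := adjoint_integrable T_preserving intf.
have fS := adjoint_pair_adjoint T_preserving intf.
have S0 := adjoint_pair_ge0 f0 intf intS fS.
have mS := integrable_mfun intS.
pose g x := Num.max (adjoint P T f x) 0.
have mg : measurable_fun setT g by exact: measurable_maxr.
have Sg : {ae P, forall x, adjoint P T f x = g x}.
  by apply: filterS S0 => x Sx0; rewrite /g max_l.
have intg : L1 g.
  apply: integrable_dominated (integrable_norm intS) => // x.
  rewrite /g; case: (leP 0 (adjoint P T f x)) => h; first by rewrite ger0_norm.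
  by rewrite normr0.
have fg : adjoint_pair P T f g.
  move=> h bh; have [mh _] := bh; rewrite -fS//; apply: Rintegral_ae_eq.
  - exact: measurable_funM.
  - exact: measurable_funM.
  - by apply: filterS Sg => x ->.
exists g; split => //.
- by move=> x; rewrite /g le_max lexx orbT.
- exact: adjoint_pair_mass fg.
- exact: Ent_ae_eq.
Qed.

End ent_adjoint.

Section entropy_limit.
Context (d : measure_display) (Omega : measurableType d) (R : realType).
Variables (P : probability Omega R).
Implicit Types (g : Omega -> R).

Let L1 f := P.-integrable setT (EFin \o f).

(** Nondecreasing in [n], with limit [x ln x + 1].  The summand [1] makes it
    nonnegative, so that monotone convergence applies even when the entropy is
    infinite; for this the level must be at least [1], hence [n.+1]. *)
Definition cut_mul_ln (n : nat) (x : R) : R := x * ln (Num.min x n.+1%:R) + 1.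

Lemma cut_mul_ln_ge0 n x : 0 <= x -> 0 <= cut_mul_ln n x.
Proof.
move=> x0; rewrite /cut_mul_ln /Order.min; case: ltP => _.
  by have := mulr_ln_ge x0; lra.
by rewrite addr_ge0// mulr_ge0// ln_ge0// ler1n.
Qed.

Lemma cut_mul_ln_nd x : 0 <= x ->
  {homo cut_mul_ln ^~ x : m n / (m <= n)%N >-> m <= n}.
Proof.
move=> x0 m n mn; rewrite /cut_mul_ln lerD2r.
move: x0; rewrite le_eqVlt => /predU1P[<-|x0]; first by rewrite !mul0r.
rewrite ler_pM2l// ler_ln ?posrE ?lt_min ?x0 ?ltr0n//.
rewrite le_min !ge_min lexx/= ler_nat ltnS mn orbT.
by [].
Qed.

Lemma cut_mul_ln_near x : \forall n \near \oo, cut_mul_ln n x = x * ln x + 1.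
Proof.
exists (Num.truncn `|x|).+1 => // n /= xn; rewrite /cut_mul_ln min_l//.
rewrite (le_trans (ler_norm _))// (le_trans (ltW (truncnS_gt _)))// ler_nat.
exact: leq_trans xn (leqnSn _).
Qed.

Lemma measurable_cut_mul_ln n g : measurable_fun setT g ->
  measurable_fun setT (fun x => cut_mul_ln n (g x)).
Proof.
move=> mg; apply: measurable_funD => //; apply: measurable_funM => //.
by apply: measurableT_comp => //; exact: measurable_minr.
Qed.

(** The negative part of [w] has integral at most [1], so that it can be moved
    across an equality of possibly infinite integrals. *)
Lemma integral_add1 (w : Omega -> R) : measurable_fun setT w ->
  (forall x, -1 <= w x) ->
  (\int[P]_x (w x + 1)%:E = \int[P]_x (w x)%:E + 1)%E.
Proof.
move=> mw w1; pose wp := ((EFin \o w)^\+)%E; pose wn := ((EFin \o w)^\-)%E.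
have mwE : measurable_fun setT (EFin \o w) by exact/measurable_EFinP.
have mwp : measurable_fun setT wp by exact: measurable_funepos.
have mwn : measurable_fun setT wn by exact: measurable_funeneg.
have int1 : (\int[P]_x (cst 1 x) = 1 :> \bar R)%E.
  by rewrite integral_cst// mul1e; exact: probability_setT.
have wn_fin : (\int[P]_x wn x \is a fin_num)%E.
  rewrite ge0_fin_numE; last first.
    by apply: integral_ge0 => x _; exact: funeneg_ge0.
  apply: (@le_lt_trans _ _ (\int[P]_x cst 1 x)%E); last by rewrite int1 ltry.
  apply: ge0_le_integral => //; first by move=> x _; exact: funeneg_ge0.
  by move=> x _; rewrite /wn funenegE /= ge_max lee_fin lee01 andbT lerNl w1.
have key : (\int[P]_x (w x + 1)%:E + \int[P]_x wn x = \int[P]_x wp x + 1)%E.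
  rewrite -[X in (_ = _ + X)%E]int1 -!ge0_integralD//.
  - apply: eq_integral => x _; rewrite /wp /wn funeposE funenegE /=.
    rewrite -!EFin_max -!EFinD; congr EFin.
    rewrite /Order.max; case: (ltP (w x) 0); case: (ltP (- w x) 0); lra.
  - by move=> x _; exact: funepos_ge0.
  - by move=> x _; rewrite lee_fin -lerBlDr sub0r.
  - by apply/measurable_EFinP; exact: measurable_funD.
  - by move=> x _; exact: funeneg_ge0.
by rewrite [in RHS]integralE -/wp -/wn addeAC -key addeK.
Qed.

Lemma cvg_cut_mul_ln g : (forall x, 0 <= g x) -> L1 g ->
  (\int[P]_x (cut_mul_ln n (g x))%:E @[n --> \oo] -->
     Ent P g + (\int[P]_x g x * ln (\int[P]_x g x) + 1)%:E)%E.
Proof.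
move=> g0 intg; have mg := integrable_mfun intg.
have -> : (Ent P g + (\int[P]_x g x * ln (\int[P]_x g x) + 1)%:E =
    \int[P]_x (g x * ln (g x) + 1)%:E)%E.
  rewrite EntE//; last exact: Rintegral_ge0.
  rewrite EFinD addeA subeK// integral_add1//.
    exact: measurable_mul_ln.
  by move=> x; exact: mulr_ln_ge.
rewrite (_ : \int[P]_x (g x * ln (g x) + 1)%:E =
    \int[P]_x limn (fun n => (cut_mul_ln n (g x))%:E))%E; last first.
  apply: eq_integral => x _; apply/esym/cvg_lim => //; apply: cvg_near_cst.
  by apply: filterS (cut_mul_ln_near (g x)) => n ->.
apply: cvg_monotone_convergence => //.
- by move=> n; apply/measurable_EFinP; exact: measurable_cut_mul_ln.
- by move=> n x _; rewrite lee_fin cut_mul_ln_ge0.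
- by move=> x _ m n mn; rewrite lee_fin cut_mul_ln_nd.
Qed.

(** The test functions that approximate [ln g]; [e] bounds them from below. *)
Lemma bounded_ln_cut n e g : 0 < e -> (forall x, 0 <= g x) ->
  measurable_fun setT g ->
  bounded_mfun (fun x => ln (Num.min (g x) n.+1%:R + e)).
Proof.
move=> e0 g0 mg; split.
  apply: measurableT_comp => //; apply: measurable_funD => //.
  exact: measurable_minr.
exists (`|ln e| + `|ln (n.+1%:R + e)|) => x.
have m0 : 0 <= Num.min (g x) n.+1%:R by rewrite le_min g0 ler0n.
have h1 : ln e <= ln (Num.min (g x) n.+1%:R + e).
  by rewrite ler_ln ?posrE//; lra.
have h2 : ln (Num.min (g x) n.+1%:R + e) <= ln (n.+1%:R + e).
  by rewrite ler_ln ?posrE ?lerD2r ?ge_min ?lexx ?orbT// ltr_wpDl.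
have := ler_norm (- ln e); have := ler_norm (ln (n.+1%:R + e)).
have := normr_ge0 (ln e); have := normr_ge0 (ln (n.+1%:R + e)).
by rewrite normrN ler_norml => ? ? ? ?; apply/andP; split; lra.
Qed.

Lemma cut_mul_ln_le n e x : 0 < e -> 0 <= x ->
  cut_mul_ln n x <= x * ln (Num.min x n.+1%:R + e) + 1.
Proof.
move=> e0; rewrite /cut_mul_ln lerD2r le_eqVlt => /predU1P[<-|x0].
  by rewrite !mul0r.
have m0 : 0 < Num.min x n.+1%:R by rewrite lt_min x0 ltr0n.
rewrite ler_pM2l// ler_ln ?posrE//; lra.
Qed.

End entropy_limit.

(** * The two implications *)

Section duality.
Context (d : measure_display) (Omega : measurableType d) (R : realType).
Variables (P : probability Omega R) (M : nat).
Variables (T : 'I_M -> R.-pker Omega ~> Omega) (c : 'I_M -> R).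
Hypothesis T_preserving : forall i, measure_preserving P (T i).
Hypothesis c_ge0 : forall i, 0 <= c i.

Let L1 f := P.-integrable setT (EFin \o f).

(** Entropy subadditivity divided by [1 - kappa]. *)
Definition entropy_subadditive : Prop := forall f, LlogL P f ->
  (\sum_(i < M) (c i)%:E * Ent P (adjoint P (T i) f) <= Ent P f)%E.

(** Let [f] be the density proportional to [exp F], where [F] is
    [log_integrand T c phi], and let [g i] be the adjoint of [T i] at [f].
    Then ln E[exp F] = E[f F] - Ent(f), and E[f F] is the sum of the
    [c i * E[g i * phi i]].  By [gibbs] each E[g i * phi i] is at most
    Ent(g i) + ln E[exp (phi i)], and subadditivity cancels the entropies. *)
Lemma brascamp_lieb_of_entropy phi : entropy_subadditive ->
  (forall i, bounded_mfun (phi i)) -> brascamp_lieb P T c phi.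
Proof.
move=> subadd bphi; apply/brascamp_lieb_ln => //.
have bF := bounded_log_integrand T c bphi.
have [] := Ent_gibbs_density P bF; set Z := \int[P]_x expR _.
set f := fun x => Z^-1 * _ => fLlogL f1 EntfE.
have [intf _] := LlogL_integrable fLlogL; have [mf f0 _] := fLlogL.
pose y i := \int[P]_x (f x * markov_op (T i) (phi i) x) -
  ln (\int[P]_x expR (phi i x)).
have yEnt i : ((y i)%:E <= Ent P (adjoint P (T i) f))%E.
  have [g [g0 intg fg g1 ->]] := adjoint_nneg_version (T_preserving i) f0 intf.
  have := gibbs g0 intg (bphi i).
  by rewrite (fg _ (bphi i)) g1 f1 mul1r.
have : (\sum_(i < M) (c i)%:E * (y i)%:E <= Ent P f)%E.
  apply: le_trans (subadd f fLlogL); apply: lee_sum => i _.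
  by apply: lee_wpmul2l; rewrite ?lee_fin.
rewrite EntfE (eq_bigr (fun i => (c i * y i)%:E))// sumEFin lee_fin.
rewrite Rintegral_log_integrand// (eq_bigr (fun i =>
  c i * \int[P]_x (f x * markov_op (T i) (phi i) x) -
  c i * ln (\int[P]_x expR (phi i x)))); last by move=> i _; rewrite -mulrBr.
by rewrite sumrB; lra.
Qed.

Lemma Ent_LlogL f : LlogL P f -> Ent P f =
  (\int[P]_x (f x * ln (f x)) - \int[P]_x f x * ln (\int[P]_x f x))%:E.
Proof.
move=> fLlogL; have [intf intl] := LlogL_integrable fLlogL.
have [_ f0 _] := fLlogL.
by rewrite EntE ?Rintegral_ge0// EFinB (EFin_Rintegral intl).
Qed.

(** For all bounded [phi], with [m = E[f]], duality, [gibbs] for [f] and the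
    Brascamp-Lieb inequality bound the sum of the [c i * E[g i * phi i]] by
    Ent(f) + m * sum of the [c i * ln E[exp (phi i)]].  The choice
    [phi i = ln g i] would give the result; it is replaced by bounded
    approximations, for which E[exp (phi i)] stays close to [m]. *)
Lemma entropy_of_brascamp_lieb :
  (forall phi, (forall i, bounded_mfun (phi i)) -> brascamp_lieb P T c phi) ->
  entropy_subadditive.
Proof.
move=> BL f fLlogL; have [intf intl] := LlogL_integrable fLlogL.
have [mf f0 _] := fLlogL.
have /choice[g gP] i := adjoint_nneg_version (T_preserving i) f0 intf.
have EntfE := Ent_LlogL fLlogL; set E := _ - _ in EntfE.
set m := \int[P]_x f x in EntfE gP.
have m0 : 0 <= m by exact: Rintegral_ge0.
have g0 i : forall x, 0 <= g i x by case: (gP i).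
have intg i : L1 (g i) by case: (gP i).
have gm i : \int[P]_x g i x = m by case: (gP i).
rewrite (eq_bigr (fun i => (c i)%:E * Ent P (g i))%E); last first.
  by move=> i _; have [_ _ _ _ ->] := gP i.
move: m0; rewrite le_eqVlt => /predU1P[m0|m0].
  rewrite Ent_mass0//.
  by rewrite big1// => i _; rewrite (Ent_mass0 (g0 i) (intg i)) ?gm// mule0.
have dual phi : (forall i, bounded_mfun (phi i)) ->
    \sum_(i < M) c i * \int[P]_x (g i x * phi i x) <=
    E + m * \sum_(i < M) c i * ln (\int[P]_x expR (phi i x)).
  move=> bphi; have /brascamp_lieb_ln := BL phi bphi => /(_ bphi).
  have := gibbs f0 intf (bounded_log_integrand T c bphi).
  rewrite EntfE lee_fin -/m Rintegral_log_integrand// => Gf lnZ.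
  have -> : \sum_(i < M) c i * \int[P]_x (g i x * phi i x) =
      \sum_(i < M) c i * \int[P]_x (f x * markov_op (T i) (phi i) x).
    apply: eq_bigr => i _; have [_ _ fg _ _] := gP i.
    by rewrite (fg _ (bphi i)).
  have := ler_wpM2l (ltW m0) lnZ; lra.
pose C := \sum_(i < M) c i.
have cut_bound n : (\sum_(i < M) (c i)%:E * \int[P]_x (cut_mul_ln n (g i x))%:E
    <= (E + m * ln m * C + C)%:E)%E.
  apply/lee_addgt0Pr => e e0.
  have mC0 : 0 <= m * C by rewrite mulr_ge0 ?(ltW m0)// sumr_ge0.
  (* An error e' in each logarithm costs m * C * e' <= e in the sum. *)
  pose e' := e / (m * C + 1).
  have e'0 : 0 < e' by rewrite divr_gt0// ltr_wpDl.
  have e'e : m * C * e' <= e.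
    rewrite mulrC /e' -mulrA ler_piMr ?(ltW e0)//.
    by rewrite mulrC ler_pdivrMr ?ltr_wpDl// mul1r lerDl.
  pose phi i x := ln (Num.min (g i x) n.+1%:R + m * e').
  have me0 : 0 < m * e' by exact: mulr_gt0.
  have bphi i : bounded_mfun (phi i).
    exact: (bounded_ln_cut n me0 (g0 i) (integrable_mfun (intg i))).
  have intgphi i : L1 (fun x => 1 * (g i x * phi i x) + 1).
    apply: integrable_combination.
      exact: integrable_mul_bounded (intg i) (bphi i).
    exact/integrable_bounded_probability/bounded_cst.
  apply: (@le_trans _ _ (\sum_(i < M)
      (c i * (\int[P]_x (g i x * phi i x) + 1))%:E)%E).
    apply: lee_sum => i _; rewrite EFinM.
    apply: lee_wpmul2l; first by rewrite lee_fin.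
    have -> : \int[P]_x (g i x * phi i x) + 1 =
        \int[P]_x (1 * (g i x * phi i x) + 1).
      rewrite Rintegral_combination ?Rintegral_probability_cst ?mul1r//.
        exact: integrable_mul_bounded (intg i) (bphi i).
      exact/integrable_bounded_probability/bounded_cst.
    rewrite EFin_Rintegral; last exact: intgphi.
    apply: ge0_le_integral => //.
    - by move=> x _; rewrite lee_fin cut_mul_ln_ge0.
    - apply/measurable_EFinP/measurable_cut_mul_ln.
      exact: integrable_mfun (intg i).
    - exact: measurable_int (intgphi i).
    - by move=> x _; rewrite lee_fin mul1r cut_mul_ln_le.
  rewrite sumEFin -EFinD lee_fin.
  under eq_bigr do rewrite mulrDr mulr1.
  rewrite big_split /= -/C.
  have lnZ i : ln (\int[P]_x expR (phi i x)) <= ln m + e'.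
    have bmin : bounded_mfun (fun x => expR (phi i x)) by exact: bounded_expR.
    have int1 : L1 (fun x => 1 * g i x + m * e').
      apply: integrable_combination (intg i) _.
      exact/integrable_bounded_probability/bounded_cst.
    have Zm : \int[P]_x expR (phi i x) <= m * (1 + e').
      apply: (@le_trans _ _ (\int[P]_x (1 * g i x + m * e'))).
        apply: le_Rintegral => //; first exact: integrable_bounded_probability.
        move=> x _; rewrite lnK ?posrE; last first.
          by rewrite ltr_wpDl// le_min g0 ler0n.
        by rewrite mul1r lerD2r ge_min lexx.
      rewrite (Rintegral_combination _ (intg i)); last first.
        exact/integrable_bounded_probability/bounded_cst.
      by rewrite Rintegral_probability_cst gm; lra.
    have e1 : 0 < 1 + e' by rewrite addr_gt0.
    apply: (@le_trans _ _ (ln (m * (1 + e')))).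
      by rewrite ler_ln ?posrE ?Rintegral_expR_gt0// mulr_gt0.
    by rewrite lnM ?posrE// lerD2l -ler_expR lnK ?posrE// expR_ge1Dx.
  have := dual phi bphi.
  have : \sum_(i < M) c i * ln (\int[P]_x expR (phi i x)) <= (ln m + e') * C.
    rewrite mulr_sumr; apply: ler_sum => i _.
    by rewrite [leRHS]mulrC ler_wpM2l.
  move=> /(ler_wpM2l (ltW m0)).
  have -> : m * ((ln m + e') * C) = m * ln m * C + m * C * e' by ring.
  lra.
have lim_le : (\sum_(i < M) (c i)%:E *
    (Ent P (g i) + (m * ln m + 1)%:E) <= (E + m * ln m * C + C)%:E)%E.
  have cvg_sum : (\sum_(i < M) (c i)%:E * \int[P]_x (cut_mul_ln n (g i x))%:E
      @[n --> \oo] --> \sum_(i < M) (c i)%:E *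
        (Ent P (g i) + (m * ln m + 1)%:E))%E.
    apply: cvg_nnesum => i _.
      apply: nearW => n; rewrite mule_ge0 ?lee_fin// integral_ge0// => x _.
      by rewrite lee_fin cut_mul_ln_ge0.
    apply: cvgeZl => //; rewrite -(gm i).
    exact: (cvg_cut_mul_ln (g0 i) (intg i)).
  rewrite -(cvg_lim _ cvg_sum)//; apply: lime_le.
    by apply/cvg_ex; eexists; exact: cvg_sum.
  by apply: nearW => n; exact: cut_bound.
rewrite EntfE; move: lim_le.
rewrite (eq_bigr (fun i => (c i)%:E * Ent P (g i) +
    (c i * (m * ln m + 1))%:E)%E); last first.
  by move=> i _; rewrite muleDr// fin_num_adde_defl.
rewrite big_split /= sumEFin -mulr_suml -/C -leeBrDr// -EFinB.
by move=> /le_trans; apply; rewrite lee_fin; lra.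
Qed.

End duality.

(** Opposite infinities add up to -oo, and a positive factor preserves this, so
    that distributivity holds for all pairs of extended reals. *)
Lemma EFin_gt0_muleDr (R : realType) (k : R) : 0 < k ->
  {morph (fun x => k%:E * x)%E : x y / (x + y)%E >-> (x + y)%E}.
Proof.
move=> k0 x y; have [xy|] := boolP (x +? y)%E; first by rewrite muleDr.
by case: x y => [x||] [y||] //= _; rewrite gt0_muley ?gt0_muleNy ?lte_fin.
Qed.

Theorem theorem1 (d : measure_display) (Omega : measurableType d) (R : realType)
    (P : probability Omega R) (M : nat) (T : 'I_M -> R.-pker Omega ~> Omega)
    (kappa : R) (theta c : 'I_M -> R) :
  (forall i, measure_preserving P (T i)) ->
  0 < kappa < 1 ->
  (forall i, 0 <= theta i) -> \sum_(i < M) theta i = 1 ->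
  (forall i, c i = theta i / (1 - kappa)) ->
  (forall f : Omega -> R, LlogL P f ->
     (\sum_(i < M) (theta i)%:E * Ent P (adjoint P (T i) f)
        <= (1 - kappa)%:E * Ent P f)%E)
  <->
  (forall phi : 'I_M -> Omega -> R, (forall i, phi i \in Lfun P +oo%E) ->
     ('E_P[fun x => (\prod_(i < M) expR (c i * markov_op (T i) (phi i) x))%R]
        <= \prod_(i < M) 'E_P[fun x => expR (phi i x)] `^ (c i))%E).
Proof.
move=> T_preserving /andP[_ kappa1] theta0 _ cE.
have k0 : 0 < 1 - kappa by rewrite subr_gt0.
have c0 i : 0 <= c i by rewrite cE divr_ge0// ltW.
have scale : (forall f : Omega -> R, LlogL P f ->
     (\sum_(i < M) (theta i)%:E * Ent P (adjoint P (T i) f)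
        <= (1 - kappa)%:E * Ent P f)%E) <-> entropy_subadditive P T c.
  have thetaE f : (\sum_(i < M) (theta i)%:E * Ent P (adjoint P (T i) f) =
      (1 - kappa)%:E * \sum_(i < M) (c i)%:E * Ent P (adjoint P (T i) f))%E.
    rewrite (big_morph _ (EFin_gt0_muleDr k0) (mule0 _)).
    apply: eq_bigr => i _; rewrite muleA -EFinM cE mulrCA divff ?mulr1//.
    by rewrite gt_eqF.
  split=> H f fLlogL; have := H f fLlogL; rewrite thetaE lee_pmul2l//;
    by rewrite lte_fin.
rewrite scale; split => [subadd phi phiL|BL].
- have [psi psiP] : exists psi : 'I_M -> Omega -> R, forall i,
      bounded_mfun (psi i) /\ {ae P, forall x, phi i x = psi i x}.
    have /choice[psi psiP] i : exists g, bounded_mfun g /\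
        {ae P, forall x, phi i x = g x}.
      by have [g bg phig] := Lfuny_bounded (phiL i); exists g.
    by exists psi.
  apply: (@brascamp_lieb_ae_eq _ _ _ _ _ _ _ T_preserving phi psi).
  + by move=> i; have /andP[] := phiL i; rewrite inE.
  + by move=> i; have [[]] := psiP i.
  + by move=> i; have [] := psiP i.
  + apply: brascamp_lieb_of_entropy => // i.
    by have [] := psiP i.
- apply: entropy_of_brascamp_lieb => // phi bphi.
  by apply: BL => i; exact: (bounded_Lfun P (leey _) (bphi i)).
Qed.
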